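(* Let $1\le p\le+\infty$, assume that $B$ is $p$-boundary admissible, let $t>0$ and $n\in\{1,2,3,\dots\}$. Then the exact positive reachability space in time $nt$ is given by $$e^+\mathcal R^{\mathrm{BC}}_{nt}=\Bigl\{\sum_{k=0}^{n-1}T(t)^kMu_k:\ u_k\in L^p([0,t],U^+),\ 0\le k\le n-1\Bigr\},$$ where $M:=\mathcal B_t^{\mathrm{BC}}\in\mathcal L\bigl(L^p([0,t],U),X\bigr)$ is the controllability map at time $t$. Moreover, the operator $M$ is positive if and only if $a^+\mathcal R^{\mathrm{BC}}_t\subset X^+$.
   Context: Abstract setting. $X$, $\partial X$, $U$ are Banach spaces, and in addition $X$ and $U$ are Banach lattices with positive cones $X^+$, $U^+$; no positivity is assumed on $T(t)$, $B$ or $Q_\lambda$. $A_m:D(A_m)\subseteq X\to X$ is a closed, densely defined operator; $Q\in\mathcal L([D(A_m)],\partial X)$, where $[D(A_m)]$ is $D(A_m)$ with the graph norm; $B\in\mathcal L(U,\partial X)$. Standing assumptions: (i) the restriction $A\subset A_m$ with domain $D(A):=\ker Q$ generates a strongly continuous semigroup $(T(t))_{t\ge0}$ on $X$; (ii) $Q:D(A_m)\to\partial X$ is surjective. For $\lambda\in\rho(A)$ the restriction $Q|_{\ker(\lambda-A_m)}$ is invertible with bounded inverse $Q_\lambda:\partial X\to\ker(\lambda-A_m)\subseteq X$, and $B_\lambda:=Q_\lambda B\in\mathcal L(U,X)$. $B$ is called $p$-boundary admissible if there exist $t>0$ and $\lambda\in\rho(A)$ such that $\int_0^tT(t-s)B_\lambda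 u(s)\,ds\in D(A)$ for all $u\in L^p([0,t],U)$; the same then holds for every $t>0$ and $\lambda\in\rho(A)$. In this case, for $t>0$ the controllability map $\mathcal B_t^{\mathrm{BC}}\in\mathcal L(L^p([0,t],U),X)$ is $\mathcal B_t^{\mathrm{BC}}u:=(\lambda-A)\int_0^tT(t-s)B_\lambda u(s)\,ds$, which does not depend on $\lambda\in\rho(A)$. $e^+\mathcal R^{\mathrm{BC}}_t:=\{\mathcal B_t^{\mathrm{BC}}u:u\in L^p([0,t],U^+)\}$ and $a^+\mathcal R^{\mathrm{BC}}_t:=\overline{e^+\mathcal R^{\mathrm{BC}}_t}$. The operator $M$ is positive if it maps $L^p([0,t],U^+)$ into $X^+$. *)

(* Defs.v *)
From HB Require Import structures.
From mathcomp Require Import all_boot all_order all_algebra.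
From mathcomp Require Import all_classical all_reals all_analysis.

Set Implicit Arguments.
Unset Strict Implicit.
Unset Printing Implicit Defensive.

Import Order.TTheory GRing.Theory Num.Theory.
Import numFieldNormedType.Exports.

Local Open Scope classical_set_scope.
Local Open Scope ring_scope.

(* Real Banach lattices.  The order, with its suprema and infima, is not an
   instance of [Order.Lattice]: Hierarchy Builder rejects a structure combining
   [Order.Lattice] with [CompleteNormedModule], because their join with
   [Num.RealDomain] is missing.  In [bl_norm_mono], [bl_sup x (- x)] is the
   modulus of [x], whereas [`|x|] is its norm. *)
HB.mixin Record isBanachLattice (R : realType) V
    of CompleteNormedModule R V := {
  bl_le : V -> V -> Prop ;
  bl_sup : V -> V -> V ;
  bl_inf : V -> V -> V ;
  bl_le_refl : forall x, bl_le x x ;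
  bl_le_anti : forall x y, bl_le x y -> bl_le y x -> x = y ;
  bl_le_trans : forall y x z, bl_le x y -> bl_le y z -> bl_le x z ;
  bl_supP : forall x y z, bl_le (bl_sup x y) z <-> bl_le x z /\ bl_le y z ;
  bl_infP : forall x y z, bl_le z (bl_inf x y) <-> bl_le z x /\ bl_le z y ;
  bl_leD : forall x y z, bl_le x y -> bl_le (x + z) (y + z) ;
  bl_scale_ge0 : forall (a : R) x, 0 <= a -> bl_le 0 x -> bl_le 0 (a *: x) ;
  bl_norm_mono : forall x y,
    bl_le (bl_sup x (- x)) (bl_sup y (- y)) -> `|x| <= `|y|
}.

#[short(type="banachLatticeType")]
HB.structure Definition BanachLattice (R : realType) :=
  { V of isBanachLattice R V & CompleteNormedModule R V }.

Definition positive_cone (R : realType) (V : banachLatticeType R) : set V :=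
  [set x | bl_le 0 x].

(* The Bochner integral of [f : R -> V] over a set [S] of finite Lebesgue
   measure; only the values of [f] on [S] matter. *)
Section Bochner.
Context (R : realType) (V : normedModType R).
Implicit Types (S : set R) (f : R -> V).

Definition simple_fun S (g : R -> V) :=
  finite_set (g @` S) /\
  forall v, measurable (S `&` g @^-1` [set v] : set (measurableTypeR R)).

Definition simple_integral S (g : R -> V) : V :=
  \sum_(v \in g @` S)
    fine (@lebesgue_measure R (S `&` g @^-1` [set v])) *: v.

Definition simple_approximation S f (g : nat -> R -> V) :=
  (forall k, simple_fun S (g k)) /\
  {ae @lebesgue_measure R, forall s, S s -> g k s @[k --> \oo] --> f s}.

Definition strongly_measurable S f := exists g, simple_approximation S f g.

Definition is_bochner_integral S f (x : V) :=
  exists g, [/\ simple_approximation S f g,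
    (\int[@lebesgue_measure R]_(s in S) (`|f s - g k s|%:E))%E
      @[k --> \oo] --> 0%E
    & simple_integral S (g k) @[k --> \oo] --> x].

(* The default value 0 is returned if [f] is not Bochner integrable. *)
Definition bochner_integral S f : V := xget 0 (is_bochner_integral S f).

(* Functions are used in place of their classes modulo a.e. equality. *)
Definition Lp_fun (p : \bar R) (t : R) : set (R -> V) :=
  [set u | strongly_measurable `[0, t] u /\
    (Lnorm (@lebesgue_measure R) p
       ((fun s => `|u s|%:E) \_ (`[0%R, t] : set R)) < +oo)%E].

End Bochner.

Definition Lp_pos (R : realType) (V : banachLatticeType R) (p : \bar R) (t : R) :
    set (R -> V) :=
  [set u | Lp_fun p t u /\
    {ae @lebesgue_measure R, forall s, s \in `[0, t] -> positive_cone (u s)}].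

(* An operator from [V] to [W] is given by its domain [D] and a total function
   [f] whose values outside of [D] are irrelevant. *)
Section UnboundedOperators.
Context (R : realType).

Definition linear_on (V W : normedModType R) (D : set V) (f : V -> W) :=
  D 0 /\ forall (a : R) x y, D x -> D y ->
    D (a *: x + y) /\ f (a *: x + y) = a *: f x + f y.

Definition closed_op (V W : normedModType R) (D : set V) (f : V -> W) :=
  closed [set z : V * W | D z.1 /\ z.2 = f z.1].

Definition graph_bounded (V W Z : normedModType R) (D : set V)
    (f : V -> W) (q : V -> Z) :=
  exists C : R, forall x, D x -> `|q x| <= C * (`|x| + `|f x|).

Context (V : normedModType R).

Definition resolvent_set (D : set V) (A : V -> V) : set R :=
  [set lam | exists S : {linear V -> V}, [/\ continuous S,
     forall x, D (S x) /\ lam *: S x - A (S x) = x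
   & forall x, D x -> S (lam *: x - A x) = x]].

(* Only the values [T t] with [0 <= t] are constrained. *)
Definition C0_semigroup (T : R -> {linear V -> V}) :=
  [/\ forall t, 0 <= t -> continuous (T t),
      forall x, T 0 x = x,
      forall s t x, 0 <= s -> 0 <= t -> T (s + t) x = T s (T t x)
    & forall x, {within `[0, +oo[, continuous (fun t => T t x)}].

Definition generates (D : set V) (A : V -> V) (T : R -> {linear V -> V}) :=
  C0_semigroup T /\ forall x y,
    (D x /\ A x = y) <-> h^-1 *: (T h x - x) @[h --> 0^'+] --> y.

End UnboundedOperators.

Section BoundaryControl.
Context (R : realType) (X U : banachLatticeType R).
Context (dX : completeNormedModType R).
Context (D : set X) (Am : X -> X) (Q : X -> dX) (B : U -> dX).
Context (T : R -> {linear X -> X}).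

Definition domA : set X := [set x | D x /\ Q x = 0].

(* For [lam] in the resolvent set of [A], [Qop lam y] is the unique [x] in
   [ker (lam - Am)] with [Q x = y]. *)
Definition Qop (lam : R) (y : dX) : X :=
  xget 0 [set x | [/\ D x, Am x = lam *: x & Q x = y]].

Definition Bop (lam : R) (v : U) : X := Qop lam (B v).

Definition input_integral (lam t : R) (u : R -> U) : X :=
  bochner_integral `[0, t] (fun s => T (t - s) (Bop lam (u s))).

Definition boundary_admissible (p : \bar R) :=
  exists t lam : R, [/\ 0 < t, resolvent_set domA Am lam
    & forall u, Lp_fun p t u -> domA (input_integral lam t u)].

(* [Am] stands for [A] here: under admissibility the integral lies in [domA],
   where the two agree. *)
Definition controllability_map (lam t : R) (u : R -> U) : X :=
  lam *: input_integral lam t u - Am (input_integral lam t u).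

Definition exact_pos_reach (p : \bar R) (lam t : R) : set X :=
  [set controllability_map lam t u | u in Lp_pos p t].

Definition approx_pos_reach (p : \bar R) (lam t : R) : set X :=
  closure (exact_pos_reach p lam t).

End BoundaryControl.

Definition positive_map (R : realType) (X U : banachLatticeType R)
    (p : \bar R) (t : R) (M : (R -> U) -> X) :=
  forall u, Lp_pos p t u -> positive_cone (M u).

(* Main.v *)
Require Import Defs.
From HB Require Import structures.
From mathcomp Require Import all_boot all_order all_algebra.
From mathcomp Require Import finmap.
From mathcomp Require Import all_classical all_reals all_analysis.
From mathcomp Require Import measurable_realfun ess_sup_inf.
From mathcomp Require Import ring lra.

Import Order.TTheory GRing.Theory Num.Theory.
Import numFieldNormedType.Exports.

Local Open Scope classical_set_scope.
Local Open Scope ring_scope.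

(* Write I_t(u) for the Bochner integral of T(t - s) B_lam u(s) over [0, t].
   If w is u on [0, a] followed by v on ]a, a + b], then
     I_(a+b)(w) = T(b) I_a(u) + I_b(v).
   Since T(b) preserves D(A) and commutes with A, admissibility at one time
   gives admissibility at the multiples of that time, hence (prepending the
   zero input) at every time, and the controllability map satisfies the same
   identity.  The formula for the reachability space at time n t follows by
   induction on n, the last piece of the input contributing the term with
   T(t)^0.  The integrals exist because B_lam is bounded (closed graph
   theorem), T is bounded on compact intervals (Banach-Steinhaus) and
   L^p is contained in L^1 on [0, t].  The positivity criterion holds because
   the cone of a Banach lattice is closed. *)

Set Implicit Arguments.
Unset Strict Implicit.
Unset Printing Implicit Defensive.

(** * Closedness of the positive cone and the closed graph theorem *)

(** Since [bochner_integral] returns 0 when no integral exists, an identity between input integrals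
    is never formal: it comes from existence on the pieces and uniqueness on the whole, both phrased
    with [is_bochner_integral]. The integrands are functions, not classes, and only a.e. limits of
    simple functions; on the exceptional null set they need not be Borel measurable. A measurable
    null set [N] is therefore carried along: removing it leaves the integral of a nonnegative
    function unchanged, and on [S] minus [N] everything is measurable. Admissibility is given at
    some resolvent point, possibly different from the one used for the reachability spaces. The
    passage rests on B_lam' = (1 + (lam - lam') R(lam', A)) B_lam: the bounded factor commutes with
    T, so it leaves the integral, and it preserves D(A). *)

Section BanachLatticeTheory.
Context (R : realType) (V : banachLatticeType R).
Implicit Types x y z : V.

Lemma bl_modulus_ge0 x : bl_le 0 (bl_sup x (- x)).
Proof.
set s := bl_sup x (- x).
have [xs nxs] : bl_le x s /\ bl_le (- x) s by apply/bl_supP; exact: bl_le_refl.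
have ss : bl_le 0 (s + s).
  apply: (bl_le_trans (x + s)).
    by have := bl_leD _ _ (x) nxs; rewrite addNr addrC.
  exact: bl_leD.
have := bl_scale_ge0 (2^-1) _ _ ss.
rewrite -mulr2n -[s *+ 2]scaler_nat scalerA mulVf ?pnatr_eq0// scale1r.
by apply; rewrite invr_ge0.
Qed.

(** The negative part [m] of a limit point [x] vanishes: for every [y] in the cone, - x <= y - x
    gives m <= |x - y| in the lattice, so the norm of [m] is at most that of [x - y], which can be
    made arbitrarily small. *)
Lemma positive_cone_closed : closed (@positive_cone R V).
Proof.
move=> x clx.
pose m := bl_sup (- x) 0.
have [nxm m0] : bl_le (- x) m /\ bl_le 0 m by apply/bl_supP; exact: bl_le_refl.
have mE : m = 0.
  apply/eqP; rewrite -normr_le0; apply/ler_addgt0Pr => e e0; rewrite add0r.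
  have [y [y0]] := clx _ (nbhsx_ballx x e e0).
  rewrite -ball_normE /= => /ltW; apply: le_trans; apply: bl_norm_mono.
  apply: (bl_le_trans (m)).
    apply/bl_supP; split; first exact: bl_le_refl.
    apply: (bl_le_trans 0) (m0).
    by have := bl_leD _ _ (- m) m0; rewrite add0r subrr.
  apply/bl_supP; split; last exact: bl_modulus_ge0.
  have [_ ] : bl_le (x - y) (bl_sup (x - y) (- (x - y))) /\
      bl_le (- (x - y)) (bl_sup (x - y) (- (x - y))).
    by apply/bl_supP; exact: bl_le_refl.
  apply: bl_le_trans; rewrite opprB.
  by have := bl_leD _ _ (- x) y0; rewrite add0r.
rewrite /positive_cone /=.
by have := bl_leD _ _ (x) nxm; rewrite addNr mE add0r.
Qed.

End BanachLatticeTheory.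

Section ClosedGraph.
Context (R : realType) (V W : completeNormedModType R) (L : {linear V -> W}).
Hypothesis graph_closed : forall (u : nat -> V) x y,
  u k @[k --> \oo] --> x -> L (u k) @[k --> \oo] --> y -> L x = y.

(* Baire: the sublevel sets of [|L x|] cover [V]. *)
Lemma approx_preimage : exists2 K : R, 0 <= K &
  forall x, exists z, `|L z| <= K * `|x| /\ `|x - z| <= `|x| / 2.
Proof.
pose A n := closure [set x | `|L x| <= n%:R].
have [n [x0 [r r0 ballA]]] : exists n x0, exists2 r : R, 0 < r & ball x0 r `<=` A n.
  apply: contrapT => noball.
  suff : dense (\bigcap_n (~` A n)).
    move=> /(_ setT) []; [by exists 0|exact: openT|move=> x [_ /= allx]].
    have := allx (Num.truncn `|L x|).+1 I; apply; apply: subset_closure => /=.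
    by apply: ltW; exact: truncnS_gt.
  apply: Baire => n; split; first by apply: closed_openC; exact: closed_closure.
  move=> O [x Ox] oO; apply/set0P/negP => /eqP OA; apply: noball.
  have /nbhs_ballP[r /= r0 br] : nbhs x O by exact: open_nbhs_nbhs.
  exists n, x, r => // y /br Oy; apply: contrapT => nA.
  by have : (O `&` ~` A n) y by []; rewrite OA.
have c0 : 0 <= (n + n)%:R :> R by [].
(* Subtracting approximants of [x0 + x] and of [x0] removes the centre of the ball and doubles the
   bound [n]. *)
have approx x e : `|x| < r -> 0 < e -> exists z, `|L z| <= (n + n)%:R /\ `|x - z| < e.
  move=> xr e0.
  have e20 : 0 < e / 2 by rewrite divr_gt0.
  have /ballA/(_ _ (nbhsx_ballx _ _ e20))[z1 [/= z1n]] : ball x0 r (x0 + x).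
    by rewrite -ball_normE /= opprD addNKr normrN.
  have /ballA/(_ _ (nbhsx_ballx _ _ e20))[z2 [/= z2n]] : ball x0 r x0.
    exact: ballxx.
  rewrite -!ball_normE /= => b2 b1.
  exists (z1 - z2); split.
    by rewrite linearB natrD (le_trans (ler_normB _ _))// lerD.
  have -> : x - (z1 - z2) = (x0 + x - z1) - (x0 - z2).
    by rewrite !opprB [RHS]addrC -(addrA x0) addrA subrK addrCA.
  by rewrite (le_lt_trans (ler_normB _ _))// (splitr e) ltrD.
exists ((n + n)%:R * 2 / r); first by rewrite !mulr_ge0// invr_ge0 ltW.
move=> x; have [->|x_neq0] := eqVneq x 0.
  by exists 0; rewrite linear0 subr0 !normr0 mulr0 mul0r.
have nx0 : 0 < `|x| by rewrite normr_gt0.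
(* Scaling by [s] brings [x] to norm [r / 2], inside the ball; undoing it yields the factor [2 / r]
   of the constant. *)
pose s := r / 2 / `|x|.
have s0 : 0 < s by rewrite !divr_gt0.
have [||z [zn zx]] := approx (s *: x) (s * (`|x| / 2)).
- rewrite normrZ gtr0_norm// /s divfK ?gt_eqF// ltr_pdivrMr// ltr_pMr// ltr1n//.
- by rewrite mulr_gt0// divr_gt0.
exists (s^-1 *: z); split.
  rewrite linearZ normrZ gtr0_norm ?invr_gt0// ler_pdivrMl// (le_trans zn)//.
  rewrite /s le_eqVlt; apply/orP; left; apply/eqP.
  by field; rewrite !gt_eqF.
have -> : x - s^-1 *: z = s^-1 *: (s *: x - z).
  by rewrite scalerBr scalerA mulVf ?gt_eqF// scale1r.
by rewrite normrZ gtr0_norm ?invr_gt0// ler_pdivrMl// ltW.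
Qed.

(** Successive approximation: [rem k] is what is left of [x] after [k] approximate preimages, and
    its norm halves each time. The images of the removed parts sum to at most [2 * K] times the norm
    of [x]. *)
Theorem closed_graph_bounded : exists2 C : R, 0 <= C & forall x, `|L x| <= C * `|x|.
Proof.
have [K K0 /choice[f fP]] := approx_preimage.
exists (2 * K) => [|x]; first by rewrite mulr_ge0.
pose rem k := iter k (fun y => y - f y) x.
have rem_le k : `|rem k| <= `|x| * 2^-1 ^+ k.
  elim: k => [|k ih] /=; first by rewrite expr0 mulr1.
  have [_ /le_trans] := fP (rem k); apply.
  by rewrite exprSr mulrA ler_wpM2r.
(* Closed form of the geometric sum of K |x| 2^-i for n <= i < n + j. *)
have step n j : `|L (rem n) - L (rem (n + j)%N)| <= 2 * K * `|x| * (2^-1 ^+ n - 2^-1 ^+ (n + j)).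
  elim: j => [|j ih]; first by rewrite addn0 !subrr normr0 mulr0.
  rewrite addnS /= linearB opprB addrA addrAC.
  rewrite (le_trans (ler_normD _ _))//.
  have [fb _] := fP (rem (n + j)%N).
  have h := le_trans fb (ler_wpM2l K0 (rem_le (n + j)%N)).
  apply: le_trans (lerD ih h) _; rewrite exprS.
  rewrite le_eqVlt; apply/orP; left; apply/eqP.
  by field.
have half0 : 2^-1 ^+ n @[n --> \oo] --> (0 : R).
  by apply: cvg_expr; rewrite ger0_norm// ?invr_ge0// invf_lt1// ltr1n.
pose b n := 2 * K * `|x| * 2^-1 ^+ n.
have b0 : b n @[n --> \oo] --> (0 : R).
  by rewrite -[X in _ --> X](mulr0 (2 * K * `|x|)); apply: cvgM => //; exact: cvg_cst.
have bP n m : (n <= m)%N -> `|L (rem n) - L (rem m)| <= b n.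
  move=> /subnKC <-; apply: le_trans (step _ _) _; rewrite /b ler_wpM2l//.
    by rewrite !mulr_ge0.
  by rewrite lerBlDr lerDl exprn_ge0// invr_ge0.
have cvgL : cvgn (fun n => L (rem n)).
  apply: cauchy_cvg; apply: cauchy_exP => e e0.
  have [N _ bN] : \forall n \near \oo, b n < e.
    by have /cvgr0Pnorm_lt/(_ e e0) := b0; apply: filterS => n /(le_lt_trans (ler_norm _)).
  exists (L (rem N)), N => // m /= Nm.
  by rewrite -ball_normE /=; exact: le_lt_trans (bP _ _ Nm) (bN _ (leqnn N)).
have rem0 : rem n @[n --> \oo] --> (0 : V).
  apply: norm_cvg0; apply: (squeeze_cvgr _ (cvg_cst 0)); last first.
    rewrite -[X in _ --> X](mulr0 `|x|); apply: cvgM half0; exact: cvg_cst.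
  by near=> n; rewrite normr_ge0 rem_le.
(* Completeness of [W] provides a limit of [L (rem n)]; the closed graph forces it to be [L 0], as
   [rem] tends to 0. *)
have lim0 : L 0 = lim (L (rem n) @[n --> \oo]) by apply: graph_closed rem0 cvgL.
rewrite linear0 in lim0.
have : `|L x - L (rem n)| @[n --> \oo] --> `|L x - 0|.
  by apply: cvg_norm; apply: cvgB; [exact: cvg_cst|rewrite lim0].
rewrite subr0 => h.
rewrite -(cvg_lim _ h)//.
apply: limr_le; first by apply/cvg_ex; eexists; exact: h.
near=> n; have := bP 0%N n (leq0n n); rewrite /b expr0 mulr1; exact.
Unshelve. all: by end_near. Qed.

End ClosedGraph.

(** * Semigroup bounds and the operators [B_lam] *)

Section SemigroupBounds.
Context (R : realType).

Lemma continuous_linear_le (V W : normedModType R) (L : {linear V -> W}) :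
  continuous L -> exists2 C : R, 0 <= C & forall x, `|L x| <= C * `|x|.
Proof.
move=> /linear_bounded_continuous/linear_boundedP bL.
have [C [C0 CP]] : exists C : R, 0 < C /\ forall x, `|L x| <= C * `|x|.
  near +oo_R => C; exists C; split; near: C => //; exact: nbhs_pinfty_gt.
by exists C => //; exact: ltW.
Unshelve. all: by end_near. Qed.

(** Pointwise boundedness comes from strong continuity: the norm along each orbit attains a maximum
    on the compact interval. *)
Lemma C0_semigroup_bounded (V : completeNormedModType R) (T : R -> {linear V -> V})
    (tau : R) : C0_semigroup T -> 0 <= tau ->
  exists2 C : R, 0 <= C & forall s x, 0 <= s <= tau -> `|T s x| <= C * `|x|.
Proof.
move=> [Tc _ _ Tsc] tau0.
pose F : set (V -> V) := [set f | exists2 s, 0 <= s <= tau & f = (T s : V -> V)].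
have [] := @Banach_Steinhauss _ _ _ F _ _ 1.
- move=> f [s /andP[s0 _] ->]; split; last exact: linearP.
  have [C C0 CP] := continuous_linear_le (Tc s s0).
  move=> r; exists (C * r) => x xr.
  by rewrite (le_trans (CP x))// ler_wpM2l.
- move=> x.
  have : {within `[0, tau], continuous (fun s => `|T s x|)}.
    have: {within `[0, tau], continuous (fun s => T s x)}.
      apply: continuous_subspaceW (Tsc x) => s /=.
      by rewrite !in_itv /= andbT => /andP[].
    by apply: within_continuous_comp => y _; exact: norm_continuous.
  move=> /(EVT_max tau0)[c _ cP]; exists `|T c x| => f [s s0t ->].
  by apply: cP; rewrite in_itv.
- move=> M MP; exists `|M| => // s x st.
  have [->|x0] := eqVneq x 0; first by rewrite linear0 !normr0 mulr0.
  have nx0 : 0 < `|x| by rewrite normr_gt0.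
  have := MP (T s) _ (`|x|^-1 *: x); rewrite linearZ !normrZ.
  rewrite normfV normr_id mulVf ?gt_eqF// ler_pdivrMl// mulrC => MPx.
  apply: le_trans (MPx _ _) _ => //; first by exists s.
  by rewrite ler_wpM2r// ler_norm.
Qed.

End SemigroupBounds.

Section LinearOn.
Context (R : realType) (V W : normedModType R) (D : set V) (f : V -> W).
Hypothesis fl : linear_on D f.

Lemma linear_onP (a : R) x y : D x -> D y -> D (a *: x + y) /\ f (a *: x + y) = a *: f x + f y.
Proof. exact: fl.2. Qed.

Lemma linear_onD x y : D x -> D y -> D (x + y) /\ f (x + y) = f x + f y.
Proof. by move=> Dx Dy; have := fl.2 1 x y Dx Dy; rewrite !scale1r. Qed.

Lemma linear_onB x y : D x -> D y -> D (x - y) /\ f (x - y) = f x - f y.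
Proof.
by move=> Dx Dy; have := fl.2 (-1) y x Dy Dx; rewrite !scaleN1r ![- _ + _]addrC.
Qed.

End LinearOn.

Section Resolvent.
Context (R : realType) (X U : banachLatticeType R) (dX : completeNormedModType R).
Context (D : set X) (Am : X -> X) (Q : X -> dX) (B : {linear U -> dX}).
Context (T : R -> {linear X -> X}).
Hypotheses (Am_linear : linear_on D Am) (Am_closed : closed_op D Am)
  (Q_linear : linear_on D Q) (Q_bounded : graph_bounded D Am Q)
  (B_bounded : continuous B) (A_generates : generates (domA D Q) Am T)
  (Q_surjective : forall y : dX, exists2 x, D x & Q x = y).

Local Notation rho := (resolvent_set (domA D Q) Am).

Lemma ker_resolvent0 (lam : R) x : rho lam -> D x -> Q x = 0 -> Am x = lam *: x -> x = 0.
Proof.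
move=> [S [_ _ SK]] Dx Qx Ax.
by rewrite -(SK x)// Ax subrr linear0.
Qed.

(** This is the decomposition of D(Am) into D(A) and ker (lam - Am): from any [x0] with boundary
    value [y], subtract the element [z] of D(A) with the same image under [lam - Am]. The boundary
    value is unchanged because [z] lies in ker Q. *)
Lemma Qop_spec (lam : R) y : rho lam ->
  [/\ D (Qop D Am Q lam y), Am (Qop D Am Q lam y) = lam *: Qop D Am Q lam y
    & Q (Qop D Am Q lam y) = y].
Proof.
move=> [S [_ SP _]]; rewrite /Qop.
set P := [set x | _]; suff : P (xget 0 P) by [].
have [x0 Dx0 Qx0] := Q_surjective y.
have [[DS QS] ES] := SP (lam *: x0 - Am x0).
set z := S _ in DS QS ES.
have [Dx AE] := linear_onB Am_linear Dx0 DS.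
have [_ QE] := linear_onB Q_linear Dx0 DS.
apply: (xgetI 0 (x := x0 - z)); split => //; last by rewrite QE QS subr0.
have -> : Am (x0 - z) = lam *: x0 - (lam *: x0 - Am x0 + Am z).
  by rewrite AE opprD opprB addrA [_ + (_ - _)]addrC subrK.
by rewrite -ES subrK scalerBr.
Qed.

Lemma Qop_unique (lam : R) x y : rho lam -> D x -> Am x = lam *: x -> Q x = y ->
  Qop D Am Q lam y = x.
Proof.
move=> rl Dx Ax Qx; have [Dz Az Qz] := Qop_spec y rl.
have [Dd Ad] := linear_onB Am_linear Dz Dx.
have [_ Qd] := linear_onB Q_linear Dz Dx.
apply/eqP; rewrite -subr_eq0; apply/eqP; apply: (ker_resolvent0 rl) => //.
  by rewrite Qd Qz Qx subrr.
by rewrite Ad Az Ax scalerBr.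
Qed.

Lemma Bop_linear (lam : R) : rho lam -> linear (Bop D Am Q B lam).
Proof.
move=> rl a u v; rewrite /Bop.
have [Du Au Qu] := Qop_spec (B u) rl; have [Dv Av Qv] := Qop_spec (B v) rl.
have [Dw Aw] := linear_onP Am_linear a Du Dv.
have [_ Qw] := linear_onP Q_linear a Du Dv.
apply: Qop_unique => //; last by rewrite Qw Qu Qv linearP.
by rewrite Aw Au Av scalerDr !scalerA [a * _]mulrC.
Qed.

(** The graph is closed: a limit [y] of [Bop lam (u k)] is in ker (lam - Am) because [Am] is closed,
    and convergence in graph norm lets [Q] pass to the limit, so that Q y = B x. The Lipschitz form
    is the one used for the existence of the integral. *)
Lemma Bop_bounded (lam : R) : rho lam ->
  exists2 C : R, 0 <= C &
    forall u v, `|Bop D Am Q B lam u - Bop D Am Q B lam v| <= C * `|u - v|.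
Proof.
move=> rl.
pose L : {linear U -> X} := HB.pack (Bop D Am Q B lam)
  (GRing.isLinear.Build _ _ _ _ _ (Bop_linear rl)).
have [|C C0 CP] := @closed_graph_bounded _ _ _ L.
  move=> u x y ux Luy; rewrite /= in Luy *.
  have uP k := Qop_spec (B (u k)) rl.
  have [Dy Ay] : D y /\ lam *: y = Am y.
    have zy : (Bop D Am Q B lam (u k), lam *: Bop D Am Q B lam (u k)) @[k --> \oo]
        --> (y, lam *: y).
      by apply: cvg_pair => //; apply: cvgZl_tmp.
    have : [set z : X * X | D z.1 /\ z.2 = Am z.1] (y, lam *: y).
      apply: (closed_cvg _ Am_closed _ _ zy).
      by apply: nearW => k /=; case: (uP k).
    by [].
  apply: Qop_unique => //.
  have [C CP] := Q_bounded.
  apply: (@cvg_unique _ _ (B (u k) @[k --> \oo])) => //; last first.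
    by apply: continuous_cvg => //; exact: B_bounded.
  pose b k := `|C| * (1 + `|lam|) * `|Bop D Am Q B lam (u k) - y|.
  have b0 : b k @[k --> \oo] --> (0 : R).
    rewrite -[X in _ --> X](mulr0 (`|C| * (1 + `|lam|))); apply: cvgM; first exact: cvg_cst.
    by rewrite -(@normr0 _ X) -(subrr y); apply: cvg_norm; apply: cvgB => //; exact: cvg_cst.
  apply/subr_cvg0; apply: norm_cvg0; apply: (squeeze_cvgr _ (cvg_cst 0) b0).
  near=> k; rewrite normr_ge0 /=.
  have [Dk Ak Qk] := uP k.
  have [Dd Ad] := linear_onB Am_linear Dk Dy.
  have [_ Qd] := linear_onB Q_linear Dk Dy.
  rewrite -[X in `|X - _|]Qk -Qd (le_trans (CP _ Dd))//.
  rewrite Ad Ak -Ay -scalerBr normrZ /b -mulrA mulrDl mul1r ler_wpM2r ?ler_norm//.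
exists C => // u v; have := CP (u - v).
by rewrite (linearB L).
Unshelve. all: by end_near. Qed.

Lemma semigroup_domA b x : 0 <= b -> domA D Q x ->
  domA D Q (T b x) /\ Am (T b x) = T b (Am x).
Proof.
have [[Tc _ TD _] genP] := A_generates.
move=> b0 Dx; apply/genP.
have /genP hx : domA D Q x /\ Am x = Am x by [].
have : T b (h^-1 *: (T h x - x)) @[h --> 0^'+] --> T b (Am x).
  by apply: continuous_cvg hx; exact: Tc.
apply: cvg_trans; apply: near_eq_cvg; near=> h.
have h0 : 0 < h by [].
by rewrite linearZ linearB /= -(TD b h x b0 (ltW h0)) -(TD h b x (ltW h0) b0) [b + h]addrC.
Unshelve. all: by end_near. Qed.

(** Both vectors have boundary value [B v], so their difference is in D(A); there [lam - A] sends it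
    to (mu - lam) B_mu v, and [S] inverts [lam - A]. *)
Lemma Bop_resolvent_identity (lam mu : R) (S : {linear X -> X}) v : rho lam -> rho mu ->
  (forall x, domA D Q x -> S (lam *: x - Am x) = x) ->
  Bop D Am Q B lam v = Bop D Am Q B mu v + (mu - lam) *: S (Bop D Am Q B mu v).
Proof.
move=> rl rm SK.
have [Dl Al Ql] := Qop_spec (B v) rl; have [Dm Am' Qm] := Qop_spec (B v) rm.
rewrite /Bop; set l := Qop D Am Q lam _ in Dl Al Ql *; set m := Qop D Am Q mu _ in Dm Am' Qm *.
have [Dd Ad] := linear_onB Am_linear Dl Dm.
have [_ Qd] := linear_onB Q_linear Dl Dm.
apply/eqP; rewrite addrC -subr_eq -linearZ; apply/eqP.
rewrite -[LHS]SK; last by split => //; rewrite Qd Ql Qm subrr.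
by congr (S _); rewrite Ad Al Am' scalerBr scalerBl opprB [LHS]addrC addrA subrK.
Qed.

Lemma resolvent_semigroup_comm (lam : R) (S : {linear X -> X}) b x : 0 <= b ->
  (forall x, domA D Q (S x) /\ lam *: S x - Am (S x) = x) ->
  (forall x, domA D Q x -> S (lam *: x - Am x) = x) ->
  S (T b x) = T b (S x).
Proof.
move=> b0 SP SK; have [Dy Ey] := SP x.
have [DTy ETy] := semigroup_domA b0 Dy.
by rewrite -[in LHS]Ey linearB linearZ /= -ETy SK.
Qed.

End Resolvent.

(** * The Bochner integral *)

Section LowerIntegral.
Import HBNNSimple.
Local Open Scope ereal_scope.
Context d (T : measurableType d) (R : realType) (mu : {measure set T -> \bar R}).

(* No measurability of [phi]: the library's integral of a nonnegative function
   is the supremum of the integrals of the simple functions below it. *)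
Lemma ge0_integral_setD_null (S N : set T) (phi : T -> \bar R) :
  measurable S -> measurable N -> mu N = 0 -> (forall x, S x -> 0 <= phi x) ->
  \int[mu]_(x in S) phi x = \int[mu]_(x in S `\` N) phi x.
Proof.
move=> mS mN N0 phi0; have mC := measurableC mN.
rewrite !ge0_integralE//; last by move=> x [/phi0].
apply/eqP; rewrite eq_le; apply/andP; split; last first.
  apply: ereal_sup_le => _ [h /= hle <-]; exists h => // x.
  apply: le_trans (hle x) _; rewrite !patchE.
  case: ifPn => [/set_mem[Sx _]|_]; first by rewrite mem_set.
  by case: ifPn => // /set_mem; exact: phi0.
(* Multiplying a simple [h] below [phi] on [S] by the indicator of the complement of [N] makes it
   admissible for the smaller set and keeps its integral. *)
apply: ge_ereal_sup => _ [h /= hle <-]; apply: ereal_sup_ubound.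
have hE x : proj_nnsfun h mC x = (h x * (x \notin N)%:R)%R.
  by rewrite /= mindicE in_setC.
exists (proj_nnsfun h mC) => [x|].
  rewrite hE patchE in_setD.
  have := hle x; rewrite patchE; case: (x \in S); case: (x \in N) => //=.
  - by rewrite mulr0.
  - by rewrite mulr1.
  - by rewrite mulr0.
  - by rewrite mulr1.
rewrite -!integralT_nnsfun; apply: ge0_ae_eq_integral => //.
- exact/measurable_EFinP.
- exact/measurable_EFinP.
- by move=> x _; rewrite lee_fin.
- by move=> x _; rewrite lee_fin.
exists N; split => // x /=; apply: contra_notP => Nx _.
by rewrite /= mindicE in_setC memNset ?mulr1.
Qed.

End LowerIntegral.

(** * Finite-valued functions and integrals of simple functions *)

Section FiniteValued.
Context d (T : measurableType d).

(* [simple_fun] with values in an arbitrary type. *)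
Definition finite_valued (A : Type) (S : set T) (g : T -> A) :=
  finite_set (g @` S) /\ forall a, measurable (S `&` g @^-1` [set a]).

(** An arbitrary preimage is a finite union of fibres, so [A] carries no sigma-algebra. *)
Lemma finite_valued_measurable_pred A S (g : T -> A) (P : set A) :
  finite_valued S g -> measurable (S `&` g @^-1` P).
Proof.
move=> [fg mg].
have -> : S `&` g @^-1` P = \bigcup_(a in (g @` S) `&` P) (S `&` g @^-1` [set a]).
  apply/seteqP; split => [s [Ss Ps]|s [a [_ Pa] [Ss /= ga]]].
    by exists (g s) => //; split => //; exists s.
  by split => //=; rewrite ga.
by apply: fin_bigcup_measurable => //; exact: finite_setIl.
Qed.

Lemma finite_valued_pair A B S (g : T -> A) (h : T -> B) :
  finite_valued S g -> finite_valued S h -> finite_valued S (fun s => (g s, h s)).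
Proof.
move=> [fg mg] [fh mh]; split.
  apply: sub_finite_set (finite_setX fg fh) => _ [s Ss <-].
  by split => /=; exists s.
move=> [a b]; rewrite [X in measurable X](_ : _ =
   (S `&` g @^-1` [set a]) `&` (S `&` h @^-1` [set b])); first exact: measurableI.
apply/seteqP; split => [s [Ss [/= <- <-]]|s [[Ss /= <-] [_ /= <-]]] //.
Qed.

Lemma finite_valued_comp A B S (g : T -> A) (c : A -> B) :
  finite_valued S g -> finite_valued S (c \o g).
Proof.
move=> gS; split; last by move=> b; exact: (finite_valued_measurable_pred (c @^-1` [set b]) gS).
by case: gS => fg _; rewrite -image_comp; exact: finite_image.
Qed.

Lemma finite_valued_subset A S S' (g : T -> A) : measurable S' -> S' `<=` S ->
  finite_valued S g -> finite_valued S' g.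
Proof.
move=> mS' S'S [fg mg]; split.
  by apply: sub_finite_set fg; exact: image_subset.
move=> a; rewrite -(setIidl S'S) -setIA; exact: measurableI.
Qed.

Lemma eq_finite_valued A S (g h : T -> A) : (forall s, S s -> g s = h s) ->
  finite_valued S g -> finite_valued S h.
Proof.
move=> gh [fg mg]; split.
  apply: sub_finite_set fg => _ [s Ss <-]; exists s => //; exact: gh.
move=> a; rewrite [X in measurable X](_ : _ = S `&` g @^-1` [set a])//.
apply/seteqP; split => s [Ss /= <-]; split => //=; first exact: gh.
by rewrite gh.
Qed.

Lemma finite_valued_setU A S1 S2 (g : T -> A) :
  finite_valued S1 g -> finite_valued S2 g -> finite_valued (S1 `|` S2) g.
Proof.
move=> [f1 m1] [f2 m2]; split; first by rewrite image_setU finite_setU.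
by move=> a; rewrite setIUl; exact: measurableU.
Qed.

Lemma finite_valued_indic S E : measurable S -> measurable (S `&` E) ->
  finite_valued S (fun s => `[< E s >]).
Proof.
move=> mS mSE; split.
  by apply: (@sub_finite_set _ _ [set: bool]) => //; exact: finite_setT.
have h : S `&` (fun s => `[< E s >]) @^-1` [set true] = S `&` E.
  by apply/seteqP; split => s [Ss /=]; [move/asboolP|move=> ?; split => //; exact/asboolP].
case; first by rewrite h.
rewrite [X in measurable X](_ : _ = S `\` (S `&` E)); first exact: measurableD.
apply/seteqP; split => s [Ss /=]; first by move/asboolP => nE; split => // -[].
by move=> nSE; split => //; apply/asboolP => Es; apply: nSE.
Qed.

End FiniteValued.

Section SimpleIntegral.
Context (R : realType) (V : normedModType R).
Implicit Types (S : set R) (g h : R -> V).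
Local Notation mu := (@lebesgue_measure R).
Local Notation mble := (@measurable _ (measurableTypeR R)).

(** Values not taken on [S] have an empty fibre and contribute 0. This puts the integrals of several
    functions over one common list. *)
Lemma simple_integral_seq S g (s : seq V) : uniq s -> (forall r, S r -> g r \in s) ->
  simple_integral S g = \sum_(v <- s) fine (mu (S `&` g @^-1` [set v])) *: v.
Proof.
move=> us gs; rewrite /simple_integral [RHS]fsbig_seq// (fsbig_widen (g @` S) [set` s])//.
- by move=> _ [r Sr <-]; exact: gs.
move=> v [_ gSv] /=.
rewrite (_ : _ `&` _ = set0) ?measure0 ?scale0r//.
by apply/seteqP; split => // r [Sr /= grv]; apply: gSv; exists r.
Qed.

(** The fibres of [p] refine those of [c \o p]. With [p] a pair of functions, both components are
    integrated over the same partition. *)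
Lemma simple_integral_comp (A : choiceType) S (p : R -> A) (c : A -> V) :
  mble S -> (mu S < +oo)%E -> @finite_valued _ (measurableTypeR R) _ S p ->
  simple_integral S (c \o p) =
    \sum_(a <- fset_set (p @` S)) fine (mu (S `&` p @^-1` [set a])) *: c a.
Proof.
move=> mS Soo [fp mp]; rewrite (partition_big_imfset _ c).
set P := fset_set _; set Z := Imfset.imfset _ _ _.
rewrite (@simple_integral_seq _ _ (enum_fset Z)) ?fset_uniq//; last first.
  move=> r Sr; apply/imfsetP; exists (p r) => //=.
  by rewrite in_fset_set// inE; exists r.
apply: eq_bigr => v _.
rewrite (eq_bigr (fun a => fine (mu (S `&` p @^-1` [set a])) *: v)); last first.
  by move=> a /eqP ->.
rewrite -scaler_suml; congr (_ *: _).
rewrite (_ : _ `&` _ =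
    \bigcup_(a in p @` S `&` c @^-1` [set v]) (S `&` p @^-1` [set a])); last first.
  apply/seteqP; split => [r [Sr /= crv]|r [a [_ /= cav] [Sr /= pra]]].
    by exists (p r) => //; split => //; exists r.
  by split => //=; rewrite pra.
have fin a : (mu (S `&` p @^-1` [set a]) \is a fin_num)%E.
  rewrite ge0_fin_numE//; apply: le_lt_trans Soo.
  by apply: le_measure; rewrite ?inE//; exact: mp.
rewrite (@measure_fin_bigcup _ (measurableTypeR R))//=; last first.
- apply/trivIsetP => a b _ _ /eqP ab; apply/seteqP; split => // r [[_ /= ar] [_ /= br]].
  by apply: ab; rewrite -ar -br.
- exact: finite_setIl.
rewrite fsbig_mkcondr fsbig_finite//= -big_mkcond/= -sum_fine//.
by apply: eq_bigl => a; apply/idP/eqP; [rewrite inE|move=> ?; rewrite inE].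
Qed.

Lemma simple_integral_dist S g h : mble S -> (mu S < +oo)%E ->
  simple_fun S g -> simple_fun S h ->
  ((`|simple_integral S g - simple_integral S h|)%:E <= \int[mu]_(s in S) (`|g s - h s|)%:E)%E.
Proof.
move=> mS Soo sg sh.
have sp : @finite_valued _ (measurableTypeR R) _ S (fun s => (g s, h s)).
  exact: finite_valued_pair.
set p := (fun s => _) in sp.
have [fp mp] := sp.
have -> : g = fst \o p by []. have -> : h = snd \o p by [].
rewrite !simple_integral_comp// -sumrB.
set P := fset_set _; set m := fun a => fine (mu (S `&` p @^-1` [set a])).
rewrite (eq_bigr (fun a => m a *: (a.1 - a.2))); last by move=> a _; rewrite scalerBr.
apply: (@le_trans _ _ (\sum_(a <- P) (m a * `|a.1 - a.2|)%:E)%E).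
  rewrite sumEFin lee_fin (le_trans (ler_norm_sum _ _ _))//.
  apply: ler_sum => a _; rewrite normrZ ger0_norm//.
  by rewrite fine_ge0.
have SE : S = \big[setU/set0]_(a <- P) (S `&` p @^-1` [set a]).
  rewrite -bigcup_seq; apply/seteqP; split => [s Ss|s [a _] []//].
  by exists (p s) => //=; rewrite in_fset_set// inE; exists s.
rewrite [X in (_ <= integral _ X _)%E]SE ge0_integral_bigsetU//=; first last.
- rewrite -SE; apply/measurable_EFinP => _ B mB.
  exact: (finite_valued_measurable_pred ((fun a => `|a.1 - a.2|) @^-1` B) sp).
- apply/trivIsetP => a b _ _ /eqP ab; apply/seteqP; split => // r [[_ /= ar] [_ /= br]].
  by apply: ab; rewrite -ar -br.
apply: lee_sum => a _.
rewrite (eq_integral (cst (`|a.1 - a.2|)%:E)); last first.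
  by move=> s; rewrite inE => -[_ /= <-].
rewrite integral_cst// EFinM muleC lee_wpmul2l//.
rewrite /m fineK// ge0_fin_numE//; apply: le_lt_trans Soo.
by apply: le_measure; rewrite ?inE//; exact: mp.
Qed.

End SimpleIntegral.

(** * Approximation off a null set and uniqueness of the Bochner integral *)

Section BochnerIntegral.
Context (R : realType).
Implicit Types S N : set R.
Local Notation mu := (@lebesgue_measure R).
Local Notation mble := (@measurable _ (measurableTypeR R)).

Section normed.
Context (V : normedModType R).
Implicit Types f h : R -> V.

(** [simple_approximation] with its exceptional set made explicit, so that measurability can be
    stated off [N]. *)
Definition approx_off S f (g : nat -> R -> V) N :=
  [/\ mble N, mu N = 0%E, (forall k, simple_fun S (g k))
    & forall s, S s -> ~ N s -> g k s @[k --> \oo] --> f s].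

Lemma simple_approximationP S f g :
  simple_approximation S f g <-> exists N, approx_off S f g N.
Proof.
split=> [[sg [N [mN N0 NP]]]|[N [mN N0 sg NP]]].
  exists N; split => // s Ss nN; apply: contrapT => ng.
  by apply: nN; apply: NP => /= /(_ Ss).
split => //; exists N; split => // s /= ns; apply: contrapT => nN.
by apply: ns => Ss; exact: NP.
Qed.

Lemma approx_off_sub S S' f g N N' : mble S' -> mble N' -> mu N' = 0%E -> S' `<=` S ->
  N `<=` N' -> approx_off S f g N -> approx_off S' f g N'.
Proof.
move=> mS' mN' N'0 S'S NN' [mN N0 sg gN]; split => //.
  by move=> k; exact: finite_valued_subset (sg k).
by move=> s /S'S Ss nN'; apply: gN => // /NN'.
Qed.

Lemma finite_valued_measurable (A : Type) S S' (p : R -> A) (c : A -> R) : mble S' ->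
  S' `<=` S ->
  @finite_valued _ (measurableTypeR R) _ S p ->
  measurable_fun (S' : set (measurableTypeR R)) (c \o p).
Proof.
move=> mS' S'S pS _ B mB.
exact: (finite_valued_measurable_pred (c @^-1` B) (finite_valued_subset mS' S'S pS)).
Qed.

Lemma simple_dist_measurable S S' g h : mble S' -> S' `<=` S ->
  simple_fun S g -> simple_fun S h ->
  measurable_fun (S' : set (measurableTypeR R)) (fun s => `|g s - h s|).
Proof.
move=> mS' S'S sg sh.
exact: (@finite_valued_measurable (V * V)%type S S' (fun s => (g s, h s))
  (fun p => `|p.1 - p.2|) mS' S'S (finite_valued_pair sg sh)).
Qed.

Lemma approx_off_measurable S f g N h : mble S -> approx_off S f g N -> simple_fun S h ->
  measurable_fun (S `\` N : set (measurableTypeR R)) (fun s => `|f s - h s|).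
Proof.
move=> mS [mN _ sg gN] sh.
have mSN : mble (S `\` N) by exact: measurableD.
apply: (@measurable_fun_cvg _ _ _ _ (fun k s => `|g k s - h s|)) => //.
  by move=> k; exact: simple_dist_measurable (@subDsetl _ S N) (sg k) sh.
move=> s [Ss nN]; apply: cvg_norm; apply: cvgB; last exact: cvg_cst.
exact: gN.
Qed.

Lemma finite_valued_cst (A : Type) S (a : A) : mble S ->
  @finite_valued _ (measurableTypeR R) _ S (fun=> a).
Proof.
move=> mS; split; first by apply: sub_finite_set (finite_set1 a) => _ [s _ <-].
move=> b; have [ab|ab] := pselect (a = b).
  by rewrite (_ : _ `&` _ = S)//; apply/seteqP; split => // s [].
by rewrite (_ : _ `&` _ = set0)//; apply/seteqP; split => // s [].
Qed.

Lemma approx_off_norm_measurable S f g N : mble S -> approx_off S f g N ->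
  measurable_fun (S `\` N : set (measurableTypeR R)) (fun s => `|f s|).
Proof.
move=> mS fg; have := approx_off_measurable mS fg (finite_valued_cst 0 mS).
by under eq_fun do rewrite subr0.
Qed.

Lemma integral_dist_off S f g N : mble S -> mble N -> mu N = 0%E ->
  (\int[mu]_(s in S) (`|f s - g s|)%:E = \int[mu]_(s in S `\` N) (`|f s - g s|)%:E)%E.
Proof. by move=> mS mN N0; apply: ge0_integral_setD_null => // s _; rewrite lee_fin. Qed.

Lemma is_bochner_integralP S f x : mble S -> is_bochner_integral S f x <->
  exists g N, [/\ approx_off S f g N,
   (\int[mu]_(s in S `\` N) (`|f s - g k s|%:E))%E @[k --> \oo] --> 0%E
   & simple_integral S (g k) @[k --> \oo] --> x].
Proof.
move=> mS; split=> [[g [/simple_approximationP[N fg] gf gx]]|[g [N [fg gf gx]]]].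
  exists g, N; split => //; case: fg => mN N0 _ _.
  by under eq_fun do rewrite -integral_dist_off//.
exists g; split => //; first by apply/simple_approximationP; exists N.
by case: fg => mN N0 _ _; under eq_fun do rewrite (@integral_dist_off S f _ N)//.
Qed.

(** Comparing two simple functions through [f] bounds the gap between their integrals by their L^1
    errors; uniqueness and the Cauchy property both follow from it. *)
Lemma simple_integral_dist_off S f g N h h' : mble S -> (mu S < +oo)%E ->
  approx_off S f g N -> simple_fun S h -> simple_fun S h' ->
  ((`|simple_integral S h - simple_integral S h'|)%:E <=
   \int[mu]_(s in S `\` N) (`|f s - h s|)%:E + \int[mu]_(s in S `\` N) (`|f s - h' s|)%:E)%E.
Proof.
move=> mS Soo fg sh sh'; have [mN N0 _ _] := fg.
have mSN : mble (S `\` N) by exact: measurableD.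
apply: le_trans (simple_integral_dist mS Soo sh sh') _.
rewrite (@integral_dist_off S h h' N)// -ge0_integralD//; first last.
- by apply/measurable_EFinP; exact: approx_off_measurable fg sh'.
- by apply/measurable_EFinP; exact: approx_off_measurable fg sh.
apply: ge0_le_integral => //.
- by apply/measurable_EFinP; exact: simple_dist_measurable (@subDsetl _ S N) sh sh'.
- by apply: emeasurable_funD; apply/measurable_EFinP; exact: approx_off_measurable fg _.
move=> s _; rewrite -EFinD lee_fin.
have -> : h s - h' s = - (f s - h s) + (f s - h' s).
  by rewrite opprB addrA subrK.
by rewrite (le_trans (ler_normD _ _))// normrN.
Qed.

Lemma is_bochner_integral_unique S f x y : mble S -> (mu S < +oo)%E ->
  is_bochner_integral S f x -> is_bochner_integral S f y -> x = y.
Proof.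
move=> mS Soo /is_bochner_integralP-/(_ mS)[g [N [fg gf gx]]].
move=> [g' [[sg' _] gf' gy]]; have [mN N0 sg _] := fg.
apply/eqP; rewrite -subr_eq0 -normr_le0 -lee_fin.
have gxy : `|simple_integral S (g k) - simple_integral S (g' k)|%:E @[k --> \oo]
    --> (`|x - y|)%:E.
  by apply: cvg_EFin; [exact: nearW|apply: cvg_norm; exact: cvgB].
have bnd : (\int[mu]_(s in S `\` N) (`|f s - g k s|)%:E +
    \int[mu]_(s in S `\` N) (`|f s - g' k s|)%:E)%E @[k --> \oo] --> 0%E.
  rewrite -[X in _ --> X]adde0; apply: cvgeD => //.
  by under eq_fun do rewrite -integral_dist_off//.
have gxy0 : `|simple_integral S (g k) - simple_integral S (g' k)|%:E @[k --> \oo] --> 0%E.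
  apply: squeeze_cvge (cvg_cst 0%E) bnd; apply: nearW => k.
  by rewrite lee_fin normr_ge0 /=; exact: simple_integral_dist_off fg (sg k) (sg' k).
by rewrite (cvg_unique _ gxy gxy0).
Qed.

Lemma bochner_integralE S f x : mble S -> (mu S < +oo)%E ->
  is_bochner_integral S f x -> bochner_integral S f = x.
Proof.
move=> mS Soo fx; apply: (is_bochner_integral_unique mS Soo) (fx).
exact: (xgetI 0 fx).
Qed.

Lemma bochner_null_measure S S' E : mble E -> mble S' -> E `<=` S -> mble S ->
  mu (S `\` S') = 0%E -> mu (S' `&` E) = mu E.
Proof.
move=> mE mS' ES mS S0; have mD : mble (E `\` S') by exact: measurableD.
have mI : mble (E `&` S') by exact: measurableI.
rewrite -[in RHS](setUIDK E S') measureU//=; last first.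
  by apply/seteqP; split => // r [[_ Sr] []].
rewrite [X in (_ + X)%E](_ : _ = 0%E) ?adde0 1?setIC//.
by apply: (subset_measure0 _ _ _ S0) => //; [exact: measurableD|exact: setSD].
Qed.

Lemma eq_is_bochner_integral S f f' x : mble S -> (forall s, S s -> f s = f' s) ->
  is_bochner_integral S f x -> is_bochner_integral S f' x.
Proof.
move=> mS ff' /is_bochner_integralP-/(_ mS)[g [N [[mN N0 sg gN] gf gx]]].
apply/is_bochner_integralP => //; exists g, N; split => //.
  by split => // s Ss nN; rewrite -ff'//; exact: gN.
rewrite (_ : (fun k => _) = (fun k => \int[mu]_(s in S `\` N) (`|f s - g k s|)%:E)%E)//.
apply/funext => k; by apply: eq_integral => s; rewrite inE => -[/ff' ->].
Qed.

(** Used to drop the endpoint 0 of [[0, b]], so that its translate by [a] is disjoint from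
    [[0, a]]. *)
Lemma is_bochner_integral_null_restrict S S' f x : mble S -> mble S' -> S' `<=` S ->
  mu (S `\` S') = 0%E -> is_bochner_integral S f x -> is_bochner_integral S' f x.
Proof.
move=> mS mS' S'S S0 /is_bochner_integralP-/(_ mS)[g [N [fg gf gx]]].
have [mN N0 sg gN] := fg.
apply/is_bochner_integralP => //; exists g, N; split.
- exact: approx_off_sub fg.
- apply: squeeze_cvge (cvg_cst 0%E) gf; apply: nearW => k.
  rewrite integral_ge0 /=; last by move=> s _; rewrite lee_fin.
  apply: ge0_subset_integral => //; [exact: measurableD|exact: measurableD| |].
  + by apply/measurable_EFinP; exact: approx_off_measurable fg (sg k).

  + by move=> s [/S'S].
- rewrite (_ : (fun k => simple_integral S' (g k)) = (fun k => simple_integral S (g k)))//.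
  apply/funext => k; have [fgk mgk] := sg k.
  rewrite !(@simple_integral_seq _ _ _ _ (fset_set (g k @` S))) ?fset_uniq//; last 2 first.
  + by move=> r Sr; rewrite in_fset_set// inE; exists r.
  + by move=> r /S'S Sr; rewrite in_fset_set// inE; exists r.
  apply: eq_bigr => v _; congr (fine _ *: _); apply/esym.
  have mm := measurableI _ _ mS' (mgk v).
  rewrite -(@bochner_null_measure S S')//.
    by rewrite setIA (setIidl S'S).
Qed.
End normed.
End BochnerIntegral.

(** * Translation, bounded operators and gluing under the Bochner integral *)

Section BochnerOperations.
Context (R : realType).
Implicit Types S N : set R.
Local Notation mu := (@lebesgue_measure R).
Local Notation mble := (@measurable _ (measurableTypeR R)).

Lemma shift_measurable (a : R) :
  measurable_fun [set: measurableTypeR R] (fun s : R => s + a : measurableTypeR R).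
Proof. by apply: measurable_funD => //; exact: measurable_cst. Qed.

Lemma measurable_shift (a : R) (A : set R) : mble A -> mble ((fun s => s + a) @^-1` A).
Proof. by move=> mA; rewrite -[X in measurable X]setTI; exact: shift_measurable. Qed.

(** The pushforward under the translation agrees with Lebesgue measure on half-open intervals, which
    determine it. *)
Lemma lebesgue_measure_shift (a : R) (A : set R) : mble A ->
  mu ((fun s => s + a) @^-1` A) = mu A.
Proof.
move=> mA; pose tau : measurableTypeR R -> measurableTypeR R := fun s => s + a.
rewrite -[LHS]/(pushforward mu tau A); apply/esym/lebesgue_measure_unique => //.
  exact: shift_measurable.
move=> ms B [[b c]] _ <-.
rewrite -[RHS]/(mu (tau @^-1` _)) (_ : tau @^-1` _ = `]b - a, c - a]%classic).

  rewrite !lebesgue_measure_itv /= !lte_fin ltrD2r.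
  by case: ifP => // _; rewrite -!EFinD; congr EFin; ring.
by apply/seteqP; split => s /=; rewrite !in_itv /= ltrBlDr lerBrDr.
Qed.

Lemma ge0_integral_shift (a : R) S (phi : R -> \bar R) : mble S ->
  measurable_fun (S : set (measurableTypeR R)) phi -> (forall s, S s -> 0 <= phi s)%E ->
  (\int[mu]_(s in (fun s => s + a)%R @^-1` S) phi (s + a)%R = \int[mu]_(s in S) phi s)%E.
Proof.
move=> mS mphi phi0.
rewrite -(@ge0_integral_pushforward _ _ (measurableTypeR R) (measurableTypeR R) R _
    (shift_measurable a))//.
  apply: eq_measure_integral => [|ms A mA _]; first exact: shift_measurable.
  exact: lebesgue_measure_shift.
by move=> s; rewrite inE; exact: phi0.
Qed.

(** L^1 convergence makes the simple integrals a Cauchy sequence; completeness of [V] supplies the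
    value. *)
Lemma is_bochner_integral_lim (V : completeNormedModType R) S (f : R -> V) g N :
  mble S -> (mu S < +oo)%E -> approx_off S f g N ->
  (\int[mu]_(s in S `\` N) (`|f s - g k s|%:E))%E @[k --> \oo] --> 0%E ->
  exists x, is_bochner_integral S f x.
Proof.
move=> mS Soo fg gf; have [mN N0 sg _] := fg.
suff [x gx] : exists x : V, simple_integral S (g k) @[k --> \oo] --> x.
  by exists x; apply/is_bochner_integralP => //; exists g, N.
suff : cvgn (fun k => simple_integral S (g k)) by move/cvg_ex.
apply: cauchy_cvg; apply: cauchy_exP => e e0.
have [K _ KP] : \forall k \near \oo,
    (\int[mu]_(s in S `\` N) (`|f s - g k s|%:E) < (e / 2)%:E)%E.
  have [gfin /(cvgr_lt 0) glt] := (fine_cvgP _ _).1 gf.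
  have := glt (e / 2); rewrite divr_gt0// => /(_ isT); apply: filterS2 gfin => k.
  by move=> /fineK <- /=; rewrite lte_fin.
exists (simple_integral S (g K)), K => // m /= Km.
rewrite -ball_normE /= -lte_fin (le_lt_trans (simple_integral_dist_off mS Soo fg (sg _) (sg _)))//.
by rewrite [e in X in (_ < X)%E](splitr e) EFinD lteD// KP//=.
Qed.

Lemma is_bochner_integral_linear (V W : normedModType R) (L : {linear V -> W}) S f x :
  continuous L -> mble S -> (mu S < +oo)%E ->
  is_bochner_integral S f x -> is_bochner_integral S (L \o f) (L x).
Proof.
move=> Lc mS Soo /is_bochner_integralP-/(_ mS)[g [N [fg gf gx]]].
have [mN N0 sg gN] := fg; have [C C0 CP] := continuous_linear_le Lc.
have Lfg : approx_off S (L \o f) (fun k => L \o g k) N.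
  split => //; first by move=> k; exact: finite_valued_comp (sg k).
  by move=> s Ss nN; apply: continuous_cvg; [exact: Lc|exact: gN].
apply/is_bochner_integralP => //; exists (fun k => L \o g k), N; split => //.
- have Cgf : (C%:E * \int[mu]_(s in S `\` N) (`|f s - g k s|%:E))%E @[k --> \oo] --> 0%E.
    by have := @cvgeZl _ _ _ _ _ (C%:E) isT gf; rewrite mule0.
  apply: squeeze_cvge (cvg_cst 0%E) Cgf.
  apply: nearW => k; rewrite integral_ge0 /=; last by move=> s _; rewrite lee_fin.
  rewrite -ge0_integralZl//; first last.
  + by apply/measurable_EFinP; exact: approx_off_measurable fg (sg k).
  + exact: measurableD.
  apply: ge0_le_integral => //.
  + exact: measurableD.
  + by apply/measurable_EFinP; exact: approx_off_measurable Lfg (finite_valued_comp L (sg k)).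
  + apply: emeasurable_funM => //.
    by apply/measurable_EFinP; exact: approx_off_measurable fg (sg k).
  + by move=> s _; rewrite -EFinM lee_fin /= -linearB.
- rewrite (_ : (fun k => _) = (fun k => L (simple_integral S (g k)))).
    by apply: continuous_cvg => //; exact: Lc.
  apply/funext => k; rewrite (simple_integral_comp L mS Soo (sg k)).
  (* Inserting [id] lets both integrals be summed over the values of [g k]. *)
  have -> : simple_integral S (g k) = simple_integral S (id \o g k) by [].
  rewrite (simple_integral_comp id mS Soo (sg k)) linear_sum /=.
  by apply: eq_bigr => v _; rewrite linearZ.
Qed.

Lemma approx_off_shift (V : normedModType R) (a : R) S (f : R -> V) g N :
  approx_off S f g N ->
  approx_off ((fun s => s + a) @^-1` S) (fun s => f (s + a)) (fun k s => g k (s + a))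
   ((fun s => s + a) @^-1` N).
Proof.
move=> [mN N0 sg gN]; split.
- exact: measurable_shift.
- by rewrite lebesgue_measure_shift.
- move=> k; have [fk mk] := sg k; split.
    by apply: sub_finite_set fk => _ [s Ss <-]; exists (s + a).
  by move=> v; exact: (measurable_shift a (mk v)).
- by move=> s Ss nN; exact: gN.
Qed.

Lemma is_bochner_integral_shift (V : normedModType R) (a : R) S (f : R -> V) x :
  mble S ->
  is_bochner_integral S f x ->
  is_bochner_integral ((fun s => s + a) @^-1` S) (fun s => f (s + a)) x.
Proof.
move=> mS /is_bochner_integralP-/(_ mS)[g [N [fg gf gx]]].
have [mN N0 sg _] := fg.
apply/is_bochner_integralP; first exact: measurable_shift.
exists (fun k s => g k (s + a)), ((fun s => s + a) @^-1` N); split.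
- exact: approx_off_shift.
- rewrite (_ : (fun k => _) = (fun k => \int[mu]_(s in S `\` N) (`|f s - g k s|)%:E)%E)//.
  apply/funext => k.
  rewrite -(@ge0_integral_shift a _ (fun s => (`|f s - g k s|)%:E))//.
  + exact: measurableD.
  + by apply/measurable_EFinP; exact: approx_off_measurable fg (sg k).
- rewrite (_ : (fun k => _) = (fun k => simple_integral S (g k)))//.
  apply/funext => k; have [fk mk] := sg k.
  rewrite !(@simple_integral_seq _ _ _ _ (fset_set (g k @` S))) ?fset_uniq//; last 2 first.
  + by move=> r Sr; rewrite in_fset_set// inE; exists r.
  + by move=> r Sr; rewrite in_fset_set// inE; exists (r + a).
  by apply: eq_bigr => v _; rewrite -(lebesgue_measure_shift a (mk v)).
Qed.

Section glue.
Context (V : normedModType R) (S1 S2 : set R).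
Hypotheses (mS1 : mble S1) (mS2 : mble S2) (S12 : [disjoint S1 & S2]).

Definition glue (A : Type) (g1 g2 : R -> A) s := if s \in S1 then g1 s else g2 s.

Lemma glueE1 (A : Type) (g1 g2 : R -> A) s : S1 s -> glue g1 g2 s = g1 s.
Proof. by move=> Ss; rewrite /glue mem_set. Qed.

Lemma glueE2 (A : Type) (g1 g2 : R -> A) s : S2 s -> glue g1 g2 s = g2 s.
Proof.
move=> Ss; rewrite /glue memNset// => S1s.
by move/disj_setPS : S12 => /(_ s); apply.
Qed.

Lemma approx_off_glue f (g1 g2 : nat -> R -> V) N1 N2 :
  approx_off S1 f g1 N1 -> approx_off S2 f g2 N2 ->
  approx_off (S1 `|` S2) f (fun k => glue (g1 k) (g2 k)) (N1 `|` N2).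
Proof.
move=> [mN1 N10 sg1 gN1] [mN2 N20 sg2 gN2]; split.
- exact: measurableU.
- by apply/negligibleP; [exact: measurableU|apply: negligibleU; apply/negligibleP].
- move=> k; apply: finite_valued_setU.
    by apply: eq_finite_valued (sg1 k) => s Ss; rewrite glueE1.
  by apply: eq_finite_valued (sg2 k) => s Ss; rewrite glueE2.
- move=> s [Ss|Ss] nN.
    by under eq_fun do rewrite glueE1//; apply: gN1 => // ?; apply: nN; left.
  by under eq_fun do rewrite glueE2//; apply: gN2 => // ?; apply: nN; right.
Qed.

Lemma is_bochner_integral_glue f x y : (mu S1 < +oo)%E -> (mu S2 < +oo)%E ->
  is_bochner_integral S1 f x -> is_bochner_integral S2 f y ->
  is_bochner_integral (S1 `|` S2) f (x + y : V).
Proof.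
move=> S1oo S2oo [g1 [/simple_approximationP[N1 fg1] gf1 gx1]].
move=> [g2 [/simple_approximationP[N2 fg2] gf2 gx2]].
have fg := approx_off_glue fg1 fg2.
set g := fun k => _ in fg; set N := N1 `|` N2 in fg.
have [mN N0 sg gN] := fg.
have mS : mble (S1 `|` S2) by exact: measurableU.
apply/is_bochner_integralP => //; exists g, N; split => //.
- rewrite (_ : (fun k => _) = (fun k =>
      \int[mu]_(s in S1) (`|f s - g1 k s|)%:E + \int[mu]_(s in S2) (`|f s - g2 k s|)%:E)%E).
    by rewrite -[X in _ --> X]adde0; apply: cvgeD.
  apply/funext => k; rewrite setDUl ge0_integral_setU//; first last.
  + apply/disj_setPS => s [[S1s _] [S2s _]].
    by move/disj_setPS : S12 => /(_ s); apply.
  + rewrite -setDUl; apply/measurable_EFinP; exact: approx_off_measurable fg (sg k).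
  + exact: measurableD.
  + exact: measurableD.
  rewrite -!integral_dist_off//; congr (_ + _)%E; apply: eq_integral => s; rewrite inE => Ss.
    by rewrite /g glueE1.
  by rewrite /g glueE2.
- rewrite (_ : (fun k => _) = (fun k => simple_integral S1 (g1 k) + simple_integral S2 (g2 k))).
    exact: cvgD.
  apply/funext => k; have [f1 m1] := (let: And4 _ _ h _ := fg1 in h) k.
  have [f2 m2] := (let: And4 _ _ h _ := fg2 in h) k.
  (* One list containing the values of both pieces, so that the three integrals add term by term. *)
  pose s := undup (enum_fset (fset_set (g1 k @` S1)) ++ enum_fset (fset_set (g2 k @` S2))).
  have s1 r : S1 r -> g1 k r \in s.
    by move=> Sr; rewrite mem_undup mem_cat in_fset_set// mem_set//; exists r.
  have s2 r : S2 r -> g2 k r \in s.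
    by move=> Sr; rewrite mem_undup mem_cat orbC in_fset_set// mem_set//; exists r.
  rewrite !(@simple_integral_seq _ _ _ _ s) ?undup_uniq//; last first.
    by move=> r [Sr|Sr]; [rewrite /g glueE1//; exact: s1|rewrite /g glueE2//; exact: s2].
  rewrite -big_split /=; apply: eq_bigr => v _; rewrite -scalerDl -fineD; last 2 first.
  + rewrite ge0_fin_numE//; apply: le_lt_trans S1oo.
    by apply: le_measure; rewrite ?inE//; exact: m1.
  + rewrite ge0_fin_numE//; apply: le_lt_trans S2oo.
    by apply: le_measure; rewrite ?inE//; exact: m2.
  rewrite -measureU; [|exact: m1|exact: m2|]; last first.
    apply/seteqP; split => // r [[S1r _] [S2r _]].
    by move/disj_setPS : S12 => /(_ r); apply.
  congr (fine (mu _) *: _); apply/seteqP; split => r /=.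
    move=> [[Sr|Sr]]; rewrite /g /=; first by rewrite glueE1//; left.
    by rewrite glueE2//; right.
  move=> [[Sr <-]|[Sr <-]]; first by rewrite /g glueE1//; split => //; left.
  by rewrite /g glueE2//; split => //; right.
Qed.

End glue.

End BochnerOperations.

(** * Existence of the integral for strongly continuous integrands *)

Section BochnerExistence.
Context (R : realType).
Implicit Types S N : set R.
Local Notation mu := (@lebesgue_measure R).
Local Notation mble := (@measurable _ (measurableTypeR R)).

Lemma lebesgue_itv_lty (a b : R) (x y : bool) :
  (mu [set` Interval (BSide x a) (BSide y b)] < +oo)%E.
Proof. by rewrite lebesgue_measure_itv/=; case: ifP => // _; rewrite ltry. Qed.

Lemma truncn_finite_valued (tau c : R) : 0 <= tau -> 0 < c ->
  @finite_valued _ (measurableTypeR R) _ `[0, tau] (fun s => Num.truncn (s * c)).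
Proof.
move=> tau0 c0; split.
  apply: (@sub_finite_set _ _ `I_(Num.truncn (tau * c)).+1); last exact: finite_II.
  move=> t [s /=]; rewrite in_itv /= => /andP[s0 st] <-.
  by rewrite /= ltnS; apply: le_truncn; rewrite ler_pM2r.
move=> n.
rewrite (_ : _ `&` _ = `[0, tau]%classic `&` `[n%:R / c, n.+1%:R / c[%classic).
  by apply: measurableI; exact: measurable_itv.
apply/seteqP; split => s [] /= s0t; rewrite [_ \in `[_, _[]in_itv /= ler_pdivrMr// ltr_pdivlMr//.
  move=> /eqP sn; split => //; rewrite -truncn_eq// mulr_ge0 ?(ltW c0)//.
  by move: s0t; rewrite in_itv /= => /andP[].
move=> nsn; split => //; exact: truncn_def.
Qed.

(** Time is rounded down to a multiple of 1 / (k + 1); rounding down keeps the point in [[0, tau]],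
    where the bounds on [F] hold. *)
Definition grid (k : nat) (s : R) : R := (Num.truncn (s * k.+1%:R))%:R / k.+1%:R.

Lemma grid_itv k (s tau : R) : 0 <= s <= tau -> 0 <= grid k s <= tau.
Proof.
move=> /andP[s0 st]; rewrite /grid divr_ge0//= ler_pdivrMr ?ltr0Sn//.
have sk0 : 0 <= s * k.+1%:R by rewrite mulr_ge0.
have /andP[h _] := truncn_itv sk0.
by rewrite (le_trans h)// ler_wpM2r.
Qed.

Lemma grid_cvg (s : R) : 0 <= s -> grid k s @[k --> \oo] --> s.
Proof.
move=> s0.
have lo : s - k.+1%:R^-1 @[k --> \oo] --> s.
  rewrite -[X in _ --> X]subr0; apply: cvgB; first exact: cvg_cst.
  exact: cvg_harmonic.
apply: (squeeze_cvgr _ lo (cvg_cst s)); apply: nearW => k.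
have sk0 : 0 <= s * k.+1%:R by rewrite mulr_ge0.
have /andP[h1 h2] := truncn_itv sk0.
rewrite /grid ler_pdivrMr ?ltr0Sn// h1 andbT ler_pdivlMr ?ltr0Sn//.
rewrite mulrBl mulVf ?pnatr_eq0// lerBlDr ltW// (lt_le_trans h2)//.
by rewrite -natr1.
Qed.

(** A strongly continuous semigroup gives continuity in time only for each fixed vector.
    Discretising both time and input yields simple functions; the Lipschitz bound, uniform in time,
    controls the error in the input, and continuity at the fixed vector [u s] the error in time. *)
Lemma is_bochner_integral_exists (U : normedModType R) (X : completeNormedModType R)
    (tau C : R) (F : R -> U -> X) (u : R -> U) : 0 <= tau -> 0 <= C ->
  (forall s, 0 <= s <= tau -> F s 0 = 0) ->
  (forall s v w, 0 <= s <= tau -> `|F s v - F s w| <= C * `|v - w|) ->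
  (forall v, {within `[0, tau], continuous (fun s => F s v)}) ->
  strongly_measurable `[0, tau] u ->
  (\int[mu]_(s in `[0%R, tau]) (`|u s|)%:E < +oo)%E ->
  exists x, is_bochner_integral `[0, tau] (fun s => F s (u s)) x.
Proof.
move=> tau0 C0 F0 FL Fc [g /simple_approximationP[N ug]] uoo.
set S : set R := `[0, tau]%classic.
have mS : mble S by exact: measurable_itv.
have SP s : S s -> 0 <= s <= tau by rewrite /S /= in_itv.
have [mN N0 sg gN] := ug.
have mSN : mble (S `\` N) by exact: measurableD.
have mnu := approx_off_norm_measurable mS ug.
have F_le s v : 0 <= s <= tau -> `|F s v| <= C * `|v|.
  by move=> st; have := FL s v 0 st; rewrite F0// !subr0.
(* Truncation to a multiple of [|u|] makes the convergence dominated. *)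
pose E k := [set s | (S `\` N) s /\ `|g k s| <= 2 * `|u s|].
have mE k : mble (S `&` E k).
  rewrite (_ : _ `&` _ = (S `\` N) `&` (fun s => `|g k s| <= 2 * `|u s|) @^-1` [set true]).
    apply: measurable_fun_ler => //.
      have := @simple_dist_measurable R U S (S `\` N) (g k) (fun=> 0) mSN (@subDsetl _ S N)
        (sg k) (finite_valued_cst 0 mS).
      by under eq_fun do rewrite subr0.
    by apply: measurable_funM => //; exact: measurable_cst.
  by apply/seteqP; split => [s [Ss []]|s [[Ss nN] /= h]].
pose v k s := if `[< E k s >] then g k s else 0.
pose h k s := F (grid k s) (v k s).
(* [h k] factors through the grid index, the truncation flag and the value of [g k], all finite
   valued. *)
have sh k : simple_fun S (h k).
  have sp : @finite_valued _ (measurableTypeR R) _ S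
      (fun s => (Num.truncn (s * k.+1%:R), (`[< E k s >], g k s))).
    apply: finite_valued_pair; first exact: truncn_finite_valued.
    by apply: finite_valued_pair; [exact: finite_valued_indic|exact: sg].
  exact: (finite_valued_comp (fun p => F (p.1%:R / k.+1%:R)
    (if p.2.1 then p.2.2 else 0)) sp).
(* Where the truncation acts, the norm of [g k s] exceeds twice that of [u s], so [g k s] is farther
   from [u s] than 0 is. *)
have v_le k s : S s -> ~ N s -> `|v k s - u s| <= `|g k s - u s|.
  move=> Ss nN; rewrite /v; case: ifPn => // /asboolPn nE.
  have lt2 : 2 * `|u s| < `|g k s|.
    by rewrite ltNge; apply/negP => le2; apply: nE.
  rewrite sub0r normrN.
  have := lerB_dist (g k s) (u s); lra.
have v2 k s : `|v k s| <= 2 * `|u s|.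
  by rewrite /v; case: ifPn => [/asboolP[]//|_]; rewrite normr0 mulr_ge0.
have uh : approx_off S (fun s => F s (u s)) h N.
  split => // s Ss nN; have st := SP s Ss; have /andP[s0 _] := st.
  have gridS : grid k s @[k --> \oo] --> within S (nbhs s).
    move=> A /= [e /= e0 eA].
    have gb : \forall k \near \oo, ball s e (grid k s) := grid_cvg s0 (nbhsx_ballx s e e0).
    rewrite -[nbhs _ _]/(\forall k \near \oo, A (grid k s)).
    apply: filterS gb => k /eA; apply; rewrite /S /= in_itv /=; exact: grid_itv.
  have Fg : F (grid k s) (u s) @[k --> \oo] --> F s (u s).
    apply: (@cvg_comp _ _ _ (grid^~ s) (fun r => F r (u s)) _ _ _ gridS).
    by have /subspace_continuousP/(_ s Ss) := Fc (u s).
  have bnd : C * `|g k s - u s| + `|F (grid k s) (u s) - F s (u s)| @[k --> \oo] --> (0 : R).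
    rewrite -[X in _ --> X]addr0; apply: cvgD.
      rewrite -[X in _ --> X](mulr0 C); apply: cvgM; first exact: cvg_cst.
      rewrite -(normr0 U) -(subrr (u s)); apply: cvg_norm; apply: cvgB; last exact: cvg_cst.
      exact: gN.
    by rewrite -(normr0 X) -(subrr (F s (u s))); apply: cvg_norm; apply: cvgB => //; exact: cvg_cst.
  apply/subr_cvg0; apply: norm_cvg0; apply: (squeeze_cvgr _ (cvg_cst 0) bnd).
  apply: nearW => k; rewrite normr_ge0 /= /h.
  rewrite -[X in `|X|](subrKA (F (grid k s) (u s))) (le_trans (ler_normD _ _))//.
  rewrite lerD2r (le_trans (FL _ _ _ (grid_itv k st)))// ler_wpM2l//.
  exact: v_le.
have mf k : measurable_fun (S `\` N : set (measurableTypeR R)) (fun s => `|F s (u s) - h k s|).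
  exact: approx_off_measurable uh (sh k).
apply: (is_bochner_integral_lim mS (lebesgue_itv_lty _ _ _ _) uh).
(* The constant 3 is 1 for [F s (u s)] plus 2 for [h k s], by the truncation. *)
have [|||||_ _] := @dominated_convergence _ (measurableTypeR R) R mu (S `\` N) mSN
  (fun k s => (`|F s (u s) - h k s|)%:E) (cst 0%E) (fun s => (3 * C * `|u s|)%:E).
- by move=> k; exact/measurable_EFinP.
- exact: measurable_cst.
- apply: aeW => s [Ss nN].
  apply: cvg_EFin; first exact: nearW.
  rewrite -(normr0 X) -(subrr (F s (u s))); apply: cvg_norm; apply: cvgB; first exact: cvg_cst.
  by case: uh => _ _ _; apply.
- apply/integrableP; split.
    apply/measurable_EFinP; apply: measurable_funM => //; exact: measurable_cst.
  under eq_integral do rewrite /= ger0_norm ?mulr_ge0// EFinM.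
  rewrite ge0_integralZl//; [|exact/measurable_EFinP|by rewrite lee_fin mulr_ge0].
  rewrite lte_mul_pinfty ?lee_fin ?mulr_ge0//.
  by rewrite -(@ge0_integral_setD_null _ _ _ mu S N)// => s _; rewrite lee_fin.
- apply: aeW => s k [Ss nN]; have st := SP s Ss.
  rewrite gee0_abs ?lee_fin// (le_trans (ler_normB _ _))//.
  have := F_le s (u s) st; have := F_le _ (v k s) (grid_itv k st).
  rewrite -/(h k s) => h1 h2; have h3 := ler_wpM2l C0 (v2 k s).
  nra.
- by rewrite integral0.
Qed.

End BochnerExistence.

(** * L^p functions *)

Section LpFunctions.
Context (R : realType).
Implicit Types S N : set R.
Local Notation mu := (@lebesgue_measure R).
Local Notation mble := (@measurable _ (measurableTypeR R)).

Lemma ae_imp (P Q : R -> Prop) : (forall s, P s -> Q s) ->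
  {ae mu, forall s, P s} -> {ae mu, forall s, Q s}.
Proof.
move=> PQ [N [mN N0 NP]]; exists N; split => // s /= nQ.
by apply: NP => /= /PQ.
Qed.

Lemma ae_and (P Q : R -> Prop) : {ae mu, forall s, P s} -> {ae mu, forall s, Q s} ->
  {ae mu, forall s, P s /\ Q s}.
Proof.
move=> [N [mN N0 NP]] [M [mM M0 MQ]]; exists (N `|` M); split.
- exact: measurableU.
- by apply/negligibleP; [exact: measurableU|apply: negligibleU; apply/negligibleP].
- move=> s /= nPQ; have [Ps|nP] := pselect (P s); last by left; exact: NP.
  by right; apply: MQ => /= Qs; apply: nPQ.
Qed.

Lemma ae_shift (a : R) (P : R -> Prop) :
  {ae mu, forall s, P s} -> {ae mu, forall s, P (s + a)}.
Proof.
move=> [N [mN N0 NP]]; exists ((fun s => s + a) @^-1` N); split.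
- exact: measurable_shift.
- by rewrite lebesgue_measure_shift.
- by move=> s /= nP; apply: NP.
Qed.

Section strongly_measurable.
Context (V : normedModType R).
Implicit Types u : R -> V.

Lemma strongly_measurable_sub S S' u : mble S' -> S' `<=` S ->
  strongly_measurable S u -> strongly_measurable S' u.
Proof.
move=> mS' S'S [g /simple_approximationP[N ug]]; exists g.
apply/simple_approximationP; exists N; have [mN N0 _ _] := ug.
exact: approx_off_sub ug.
Qed.

Lemma strongly_measurable_shift a S u : strongly_measurable S u ->
  strongly_measurable ((fun s => s + a) @^-1` S) (fun s => u (s + a)).
Proof.
move=> [g /simple_approximationP[N ug]]; exists (fun k s => g k (s + a)).
apply/simple_approximationP; exists ((fun s => s + a) @^-1` N).
exact: approx_off_shift.
Qed.

Lemma strongly_measurable_setU S1 S2 u : [disjoint S1 & S2] -> mble S1 -> mble S2 ->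
  strongly_measurable S1 u -> strongly_measurable S2 u ->
  strongly_measurable (S1 `|` S2) u.
Proof.
move=> S12 mS1 mS2 [g1 /simple_approximationP[N1 ug1]] [g2 /simple_approximationP[N2 ug2]].
exists (fun k => glue S1 (g1 k) (g2 k)); apply/simple_approximationP.
by exists (N1 `|` N2); exact: approx_off_glue.
Qed.

Lemma eq_strongly_measurable S u u' : (forall s, S s -> u s = u' s) ->
  strongly_measurable S u -> strongly_measurable S u'.
Proof.
move=> uu' [g [sg [N [mN N0 NP]]]]; exists g; split => //; exists N; split => //.
by move=> s /= ns; apply: NP => /= us; apply: ns => Ss; rewrite -uu'//; exact: us.
Qed.

(** Finiteness of the p-norm without the root and over any [S], so that cutting and translating [S]
    act directly on the condition. *)
Definition Lp_cond (p : \bar R) S u : Prop :=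
  match p with
  | r%:E => (\int[mu]_(s in S) (`|u s| `^ r)%:E < +oo)%E
  | +oo%E => exists C, {ae mu, forall s, S s -> `|u s| <= C}
  | -oo%E => True
  end.

Definition Lp_on p S u := strongly_measurable S u /\ Lp_cond p S u.

Lemma Lp_funE p t u : (1 <= p)%E -> Lp_fun p t u <-> Lp_on p `[0, t] u.
Proof.
move=> p1; rewrite /Lp_fun /Lp_on /=.
suff -> : (Lnorm mu p ((fun s => `|u s|%:E) \_ (`[0%R, t] : set R)) < +oo)%E <->
  Lp_cond p `[0, t] u by [].
rewrite unlock; case: p p1 => [r|_|//].
  rewrite lee_fin => r1; have r0 : 0 < r by rewrite (lt_le_trans _ r1).
  rewrite /= (_ : integral _ _ _ = \int[mu]_(s in `[0%R, t]) (`|u s| `^ r)%:E)%E; last first.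
    rewrite [RHS]integral_mkcond; apply: eq_integral => s _.
    rewrite !patchE; case: ifPn => _ /=; first by rewrite normr_id.
    by rewrite normr0 powR0// gt_eqF.
  split; last exact: poweR_lty.
  by rewrite !ltey; apply: contra_neqN => /eqP ->; rewrite poweRyr// gt_eqF// invr_gt0.
(* The norm for [+oo] is the essential supremum only on a space of positive measure. *)
have -> : (0 < mu [set: R])%E.
  apply: (@lt_le_trans _ _ (mu `[0%R, 1%R])).
    by rewrite lebesgue_measure_itv/= lte01 sube0 lte01.
  by apply: le_measure; rewrite ?inE//; exact: measurable_itv.
rewrite /Lp_cond; set f := (_ \o _); split => [fin|[C uC]].
  (* The maximum with 0 excludes the value [-oo], so that [fine] loses nothing. *)
  exists (fine (maxe (ess_sup mu f) 0%E)).
  apply: ae_imp (ess_sup_ge mu f) => s fs Ss; rewrite -lee_fin fineK.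
    apply: le_trans (le_trans fs _); last by rewrite le_max lexx.
    by rewrite /f /= patchE mem_set//= normr_id.
  rewrite ge0_fin_numE; last by rewrite le_max lexx orbT.
  by rewrite gt_max fin ltry.
apply: (@le_lt_trans _ _ (Num.max C 0)%:E); last exact: ltry.
apply/ess_supP; apply: ae_imp uC => s uC.
rewrite /f /= patchE; case: ifPn => [/set_mem/uC us|_]/=.
  by rewrite normr_id lee_fin le_max us.
by rewrite normr0 lee_fin le_max lexx orbT.
Qed.

Lemma powR_norm_measurable S u g N r : mble S -> approx_off S u g N ->
  measurable_fun (S `\` N : set (measurableTypeR R)) (fun s => (`|u s| `^ r)%:E).
Proof.
move=> mS ug; apply/measurable_EFinP.
apply: (@measurableT_comp _ _ _ _ _ _ (@powR R ^~ r)); first exact: measurable_powR.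
exact: approx_off_norm_measurable ug.
Qed.

Lemma Lp_on_sub p S S' u : mble S -> mble S' -> S' `<=` S -> Lp_on p S u -> Lp_on p S' u.
Proof.
move=> mS mS' S'S [su up]; split; first exact: strongly_measurable_sub su.
have [g /simple_approximationP[N ug]] := su; have [mN N0 _ _] := ug.
case: p up => [r /=||//].
  have pow_ge0 s : (0 <= (`|u s| `^ r)%:E)%E by rewrite lee_fin powR_ge0.
  rewrite (ge0_integral_setD_null mS mN N0)// (ge0_integral_setD_null mS' mN N0)//.
  apply: le_lt_trans; apply: ge0_subset_integral => //; [exact: measurableD|exact: measurableD| |].
    exact: powR_norm_measurable ug.
  exact: setSD.
move=> [C uC]; exists C; apply: ae_imp uC => s uC /S'S; exact: uC.
Qed.

Lemma Lp_on_shift p a S u : mble S -> Lp_on p S u ->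
  Lp_on p ((fun s => s + a) @^-1` S) (fun s => u (s + a)).
Proof.
move=> mS [su up]; split; first exact: strongly_measurable_shift.
have [g /simple_approximationP[N ug]] := su; have [mN N0 _ _] := ug.
case: p up => [r /=||//].
  have pow_ge0 s : (0 <= (`|u s| `^ r)%:E)%E by rewrite lee_fin powR_ge0.
  have N0' : mu ((fun s => s + a) @^-1` N) = 0%E by rewrite lebesgue_measure_shift.
  move=> uoo.
  rewrite (ge0_integral_setD_null (measurable_shift a mS) (measurable_shift a mN) N0')//.
  have -> := @ge0_integral_shift _ a (S `\` N) (fun s => (`|u s| `^ r)%:E)
    (measurableD mS mN) (powR_norm_measurable r mS ug) (fun s _ => pow_ge0 s).
  by rewrite -(ge0_integral_setD_null mS mN N0).
by move=> [C uC]; exists C; exact: ae_shift uC.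
Qed.

Lemma Lp_on_setU p S1 S2 u : [disjoint S1 & S2] -> mble S1 -> mble S2 ->
  Lp_on p S1 u -> Lp_on p S2 u -> Lp_on p (S1 `|` S2) u.
Proof.
move=> S12 mS1 mS2 [su1 up1] [su2 up2].
have mS : mble (S1 `|` S2) by exact: measurableU.
have su := strongly_measurable_setU S12 mS1 mS2 su1 su2; split => //.
have [g /simple_approximationP[N ug]] := su; have [mN N0 _ _] := ug.
case: p up1 up2 => [r /=||//].
  have pow_ge0 s : (0 <= (`|u s| `^ r)%:E)%E by rewrite lee_fin powR_ge0.
  rewrite (ge0_integral_setD_null mS mN N0)// (ge0_integral_setD_null mS1 mN N0)//.
  rewrite (ge0_integral_setD_null mS2 mN N0)// setDUl => h1 h2.
  rewrite ge0_integral_setU//; [exact: lte_add_pinfty|exact: measurableD|exact: measurableD| |].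
    by rewrite -setDUl; exact: powR_norm_measurable ug.
  apply/disj_setPS => s [[S1s _] [S2s _]].
  by move/disj_setPS : S12 => /(_ s); apply.
move=> [C1 uC1] [C2 uC2]; exists (Num.max C1 C2); apply: ae_imp (ae_and uC1 uC2) => s [u1 u2].
by rewrite le_max => -[/u1 ->//|/u2 ->]; rewrite orbT.
Qed.

Lemma eq_Lp_on p S u u' : (forall s, S s -> u s = u' s) -> Lp_on p S u -> Lp_on p S u'.
Proof.
move=> uu' [su up]; split; first exact: eq_strongly_measurable su.
case: p up => [r /=||//].
  have -> // : (\int[mu]_(s in S) (`|u' s| `^ r)%:E = \int[mu]_(s in S) (`|u s| `^ r)%:E)%E.
  by apply: eq_integral => s; rewrite inE => /uu' ->.
by move=> [C uC]; exists C; apply: ae_imp uC => s uC Ss; rewrite -uu'//; exact: uC.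
Qed.

(** For finite exponent [r], the pointwise bound |u| <= 1 + |u|^r and the finite measure of [S]
    suffice, in place of the Hoelder inequality. *)
Lemma Lp_on_integrable p S u : (1 <= p)%E -> mble S -> (mu S < +oo)%E -> Lp_on p S u ->
  (\int[mu]_(s in S) (`|u s|)%:E < +oo)%E.
Proof.
move=> p1 mS Soo [[g /simple_approximationP[N ug]] up]; have [mN N0 _ _] := ug.
have mSN : mble (S `\` N) by exact: measurableD.
have mnu : measurable_fun (S `\` N : set (measurableTypeR R)) (fun s => (`|u s|)%:E).
  by apply/measurable_EFinP; exact: approx_off_norm_measurable ug.
have SNoo : (mu (S `\` N) < +oo)%E.
  by apply: le_lt_trans Soo; apply: le_measure; rewrite ?inE//; exact: subDsetl.
case: p p1 up => [r|_|//] /=.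
  rewrite lee_fin => r1 up.
  have pow_ge0 s : (0 <= (`|u s| `^ r)%:E)%E by rewrite lee_fin powR_ge0.
  rewrite (ge0_integral_setD_null mS mN N0)//.
  apply: (@le_lt_trans _ _ (\int[mu]_(s in S `\` N) ((cst 1%E s) + (`|u s| `^ r)%:E))%E).
    apply: ge0_le_integral => //.
    + apply: emeasurable_funD; first exact: measurable_cst.
      exact: powR_norm_measurable ug.
    + move=> s _; rewrite -EFinD lee_fin.
      have [le1|ge1] := leP `|u s| 1; first by rewrite (le_trans le1)// lerDl powR_ge0.
      rewrite -[X in X <= _](powRr1 (normr_ge0 _)) (le_trans (ler_powR _ r1)) ?ltW//.
      by rewrite ltrDr.
  rewrite ge0_integralD//; [|exact: powR_norm_measurable ug].
  rewrite integral_cst// mul1e lte_add_pinfty//.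
  by rewrite -(ge0_integral_setD_null mS mN N0).
move=> [C [N' [mN' N'0 NC]]].
pose M := N `|` N'.
have mM : mble M by exact: measurableU.
have M0 : mu M = 0%E.
  by apply/negligibleP => //; apply: negligibleU; apply/negligibleP.
rewrite (ge0_integral_setD_null mS mM M0)//.
have mSM : mble (S `\` M) by exact: measurableD.
apply: (@le_lt_trans _ _ (\int[mu]_(s in S `\` M) cst (Num.max C 0)%:E s)%E).
  apply: ge0_le_integral => //.
  + by apply: measurable_funS mnu => //; apply: setDS; exact: subsetUl.
  + move=> s [Ss nM]; rewrite lee_fin le_max; apply/orP; left.
    by apply: contrapT => nC; apply: nM; right; apply: NC => /= /(_ Ss).
rewrite integral_cst// lte_mul_pinfty ?lee_fin ?le_max ?lexx ?orbT//.
by apply: le_lt_trans Soo; apply: le_measure; rewrite ?inE//; exact: subDsetl.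
Qed.

End strongly_measurable.
End LpFunctions.

(** * Concatenation of inputs *)

Section Concatenation.
Context (R : realType) (U : normedModType R).
Implicit Types u v w : R -> U.
Local Notation mu := (@lebesgue_measure R).
Local Notation mble := (@measurable _ (measurableTypeR R)).

(** The first input takes the junction point, so [v] is read only at positive times. *)
Definition concat (a : R) u v s := if s <= a then u s else v (s - a).

Lemma concatE1 a u v s : s <= a -> concat a u v s = u s.
Proof. by rewrite /concat => ->. Qed.

Lemma concatE2 a u v r : 0 < r -> concat a u v (r + a) = v r.
Proof. by move=> r0; rewrite /concat gerDr leNgt r0 addrK. Qed.

Lemma preimage_shift_itv (a b c : R) x y :
  (fun s => s - a) @^-1` [set` Interval (BSide x b) (BSide y c)] =
  [set` Interval (BSide x (b + a)) (BSide y (c + a))].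
Proof.
by apply/seteqP; split => s /=; rewrite !in_itv /=; case: x; case: y;
  rewrite /= ?lerBrDr ?ltrBrDr ?lerBlDr ?ltrBlDr.
Qed.

Lemma disjoint_itv_cc_oc (a b c : R) : [disjoint (`[a, b] : set R) & (`]b, c] : set R)].
Proof.
apply/disj_setPS => s []; rewrite /= !in_itv /= => /andP[_ sb] /andP[bs _].
by move: (lt_le_trans bs sb); rewrite ltxx.
Qed.

Lemma setU_itv_cc_oc (a b : R) : 0 <= a -> 0 <= b ->
  `[0, a]%classic `|` `]a, b + a]%classic = `[0, b + a]%classic :> set R.
Proof.
move=> a0 b0; apply/seteqP; split => s; rewrite /= !in_itv /=; lra.
Qed.

Lemma mble_itv (a b : R) x y : mble [set` Interval (BSide x a) (BSide y b)].
Proof. exact: measurable_itv. Qed.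

Variables (p : \bar R) (a b : R).
Hypotheses (a0 : 0 <= a) (b0 : 0 <= b).

Lemma Lp_on_concat u v w : Lp_on p `[0, a] u -> Lp_on p `[0, b] v ->
  (forall s, `[0, a]%classic s -> w s = u s) ->
  (forall r, `]0, b]%classic r -> w (r + a) = v r) -> Lp_on p `[0, b + a] w.
Proof.
move=> up vp wu wv; rewrite -setU_itv_cc_oc//.
apply: Lp_on_setU; [exact: disjoint_itv_cc_oc|exact: mble_itv|exact: mble_itv| |].
  by apply: eq_Lp_on up => s sa; rewrite wu.
have : Lp_on p `]0, b] v.
  apply: Lp_on_sub vp; [exact: mble_itv|exact: mble_itv|].
  by apply: subset_itvr; rewrite bnd_simp.
move=> /(Lp_on_shift (- a) (mble_itv _ _ _ _)); rewrite preimage_shift_itv add0r.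
apply: eq_Lp_on => s sab; rewrite -wv ?subrK//.
by move: sab; rewrite /= !in_itv /=; lra.
Qed.

Lemma Lp_on_left w : Lp_on p `[0, b + a] w -> Lp_on p `[0, a] w.
Proof.
apply: Lp_on_sub; [exact: mble_itv|exact: mble_itv|].
by move=> s; rewrite /= !in_itv /= => /andP[-> sa]; rewrite (le_trans sa)// lerDr.
Qed.

Lemma Lp_on_right w : Lp_on p `[0, b + a] w -> Lp_on p `[0, b] (fun r => w (r + a)).
Proof.
move=> /(Lp_on_sub (mble_itv _ _ _ _) (mble_itv a (b + a) true false)) wp.
have /wp /(Lp_on_shift a (mble_itv _ _ _ _)) :
    `[a, b + a]%classic `<=` (`[0, b + a]%classic : set R).
  by move=> s; rewrite /= !in_itv /= => /andP[sa ->]; rewrite (le_trans a0 sa).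
by have := preimage_shift_itv (- a) a (b + a) true false; rewrite opprK subrr addrK => ->.
Qed.

End Concatenation.

(** * Input integrals, admissibility and the controllability map *)

Section Input.
Context (R : realType) (X U : banachLatticeType R) (dX : completeNormedModType R).
Context (D : set X) (Am : X -> X) (Q : X -> dX) (B : {linear U -> dX}).
Context (T : R -> {linear X -> X}).
Hypotheses (Am_linear : linear_on D Am) (Am_closed : closed_op D Am)
  (Q_linear : linear_on D Q) (Q_bounded : graph_bounded D Am Q)
  (B_bounded : continuous B) (A_generates : generates (domA D Q) Am T)
  (Q_surjective : forall y : dX, exists2 x, D x & Q x = y).
Context (p : \bar R) (p_ge1 : (1 <= p)%E).

Local Notation mu := (@lebesgue_measure R).
Local Notation mble := (@measurable _ (measurableTypeR R)).
Local Notation rho := (resolvent_set (domA D Q) Am).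
Local Notation input := (input_integral D Am Q B T).
Local Notation Bl := (Bop D Am Q B).
Local Notation Lp t := (@Lp_on R U p `[0, t]).

Lemma Bop0 (lam : R) : rho lam -> Bl lam 0 = 0.
Proof.
move=> rl; have := Bop_linear B Am_linear Q_linear Q_surjective rl 1 0 0.
by rewrite scale1r addr0 scale1r -[LHS]addr0 => /addrI/esym.
Qed.

Lemma input_integralP (lam tau : R) u : rho lam -> 0 <= tau -> Lp tau u ->
  is_bochner_integral `[0, tau] (fun s => T (tau - s) (Bl lam (u s))) (input lam tau u).
Proof.
move=> rl tau0 up; have [TC0 _] := A_generates.
have [CT CT0 TP] := C0_semigroup_bounded TC0 tau0.
have [CB CB0 BP] := Bop_bounded Am_linear Am_closed Q_linear Q_bounded B_bounded Q_surjective rl.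
have [_ _ _ Tsc] := TC0.
have B0 := Bop0 rl.
have sub_itv s : 0 <= s <= tau -> 0 <= tau - s <= tau.
  by move=> /andP[s0 st]; rewrite subr_ge0 st lerBlDr lerDl.
have [||s st|s v w st|v|||x xP] := @is_bochner_integral_exists R U X tau (CT * CB)
  (fun s v => T (tau - s) (Bl lam v)) u.
- by [].
- by rewrite mulr_ge0.
- by rewrite B0 linear0.
- rewrite -linearB (le_trans (TP _ _ (sub_itv s st)))// -mulrA ler_wpM2l//.
- apply/subspace_continuousP => s st.
  (* Orbits are continuous only relative to nonnegative times, so the time reversal must respect the
     restricted neighbourhoods. *)
  have c : (tau - r) @[r --> within `[0, tau] (nbhs s)] --> within `[0, +oo[ (nbhs (tau - s)).
    move=> A /= [e /= e0 eA]; exists e => //= r sr; rewrite /= in_itv /= => /andP[r0 rt].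
    apply: eA; last by rewrite /= in_itv /= andbT subr_ge0.
    rewrite /= (_ : tau - s - (tau - r) = - (s - r)) ?normrN//; ring.
  apply: (@cvg_comp _ _ _ (fun r => tau - r) (fun r => T r (Bl lam v)) _ _ _ c).
  have /subspace_continuousP := Tsc (Bl lam v); apply.
  by move: st; rewrite /= !in_itv /= andbT subr_ge0 => /andP[].
- by case: up.
- by apply: (Lp_on_integrable p_ge1 (mble_itv _ _ _ _) (lebesgue_itv_lty _ _ _ _) up).
by rewrite /input_integral (bochner_integralE (mble_itv _ _ _ _) (lebesgue_itv_lty _ _ _ _) xP).
Qed.

(** [w] is described by its two pieces rather than as a [concat], so the same identity assembles
    inputs and, with [u := w], splits a given one. *)
Lemma input_integral_concat (lam a b : R) u v w : rho lam -> 0 <= a -> 0 <= b ->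
  Lp a u -> Lp b v ->
  (forall s, `[0, a]%classic s -> w s = u s) ->
  (forall r, `]0, b]%classic r -> w (r + a) = v r) ->
  input lam (b + a) w = T b (input lam a u) + input lam b v.
Proof.
move=> rl a0 b0 up vp wu wv; have [[Tc _ TD _] _] := A_generates.
apply: bochner_integralE; [exact: mble_itv|exact: lebesgue_itv_lty|].
rewrite -setU_itv_cc_oc//.
apply: is_bochner_integral_glue; [exact: mble_itv|exact: mble_itv|exact: disjoint_itv_cc_oc|
  exact: lebesgue_itv_lty|exact: lebesgue_itv_lty| |].
  have := input_integralP rl a0 up.
  move=> /(is_bochner_integral_linear (Tc b b0) (mble_itv _ _ _ _)
    (lebesgue_itv_lty _ _ _ _)).
  apply: eq_is_bochner_integral; first exact: mble_itv.
  move=> s sa; rewrite /= -TD ?wu// ?addrA//.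
  by move: sa; rewrite /= in_itv /= subr_ge0 => /andP[].
have := input_integralP rl b0 vp.
move=> /(@is_bochner_integral_null_restrict _ _ _ `]0, b]).
move=> /(_ (mble_itv _ _ _ _) (mble_itv _ _ _ _)) h.
have {h} : is_bochner_integral `]0, b] (fun s => T (b - s) (Bl lam (v s))) (input lam b v).
  apply: h; first by apply: subset_itvr; rewrite bnd_simp.
  rewrite (_ : _ `\` _ = [set 0]); first exact: lebesgue_measure_set1.
  apply/seteqP; split => s; rewrite /= !in_itv /=.
    move=> [/andP[s0 sb] ns]; apply/eqP; rewrite eq_le s0 andbT leNgt.
    by apply/negP => s0'; apply: ns; rewrite s0'.
  by move=> ->; rewrite lexx b0 ltxx.
move=> /(is_bochner_integral_shift (- a) (mble_itv _ _ _ _)); rewrite preimage_shift_itv add0r.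
apply: eq_is_bochner_integral; first exact: mble_itv.
move=> s sab; rewrite -wv ?subrK; last by move: sab; rewrite /= !in_itv /=; lra.
by congr (T _ _); ring.
Qed.

Lemma domA_linear : linear_on (domA D Q) Am.
Proof.
split=> [|c x y [Dx Qx] [Dy Qy]].
  split; first by case: Am_linear.
  have [D0 _] := Q_linear.
  by have := linear_onB Q_linear D0 D0; rewrite !subrr => -[].
have [Dz Az] := linear_onP Am_linear c Dx Dy.
have [_ Qz] := linear_onP Q_linear c Dx Dy.
by split => //; split => //; rewrite Qz Qx Qy scaler0 addr0.
Qed.

(** By the resolvent identity, the integral at [lam'] is the image of the one at [lam] under [L].
    Since [S] has values in D(A), [L] maps D(A) into itself. *)
Lemma input_integral_domA_resolvent (lam lam' t : R) u : rho lam -> rho lam' -> 0 <= t ->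
  Lp t u -> domA D Q (input lam t u) -> domA D Q (input lam' t u).
Proof.
move=> rl rl' t0 up Dx; have [S [Sc SP SK]] := rl'.
set x := input lam t u in Dx.
have Ll : linear (fun y : X => y + (lam - lam') *: S y).
  move=> c y z; rewrite linearP scalerDr (scalerA _ c) (mulrC _ c) -scalerA.
  by rewrite addrACA -scalerDr.
pose L : {linear X -> X} := HB.pack (fun y : X => y + (lam - lam') *: S y)
  (GRing.isLinear.Build _ _ _ _ _ Ll).
have Lc : continuous L.
  by move=> y; apply: cvgD; [exact: cvg_id|apply: cvgZl_tmp; exact: Sc].
suff -> : input lam' t u = L x.
  have [DS _] := SP x; have [+ _] := linear_onP domA_linear (lam - lam') DS Dx.
  by rewrite addrC.
apply: bochner_integralE; [exact: mble_itv|exact: lebesgue_itv_lty|].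
have := is_bochner_integral_linear Lc (mble_itv _ _ _ _) (lebesgue_itv_lty _ _ _ _)
  (input_integralP rl t0 up).
apply: eq_is_bochner_integral; first exact: mble_itv.
move=> s; rewrite /= in_itv /= => /andP[_ st].
have ts0 : 0 <= t - s by rewrite subr_ge0.
rewrite (resolvent_semigroup_comm A_generates _ ts0 SP SK).
rewrite -linearZ -linearD; congr (T _ _).
exact/esym/Bop_resolvent_identity.
Qed.

Lemma Lp_on0 t : Lp t (fun=> 0).
Proof.
split.
  exists (fun _ _ => 0); split; first by move=> k; exact: finite_valued_cst (mble_itv _ _ _ _).
  by exists set0; split => // s /= []; move=> _; exact: cvg_cst.
case: p p_ge1 => [r|_|//].
  rewrite lee_fin /= => r1; under eq_integral do rewrite normr0 powR0 ?gt_eqF ?(lt_le_trans _ r1)//.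
  by rewrite integral0.
by exists 0; apply: aeW => s _; rewrite normr0.
Qed.

Lemma input_integral0 (lam t : R) : rho lam -> 0 <= t -> input lam t (fun=> 0) = 0.
Proof.
(* The zero operator sends both the integrand and its integral to 0, which identifies the integral
   of the zero function. *)
move=> rl t0; have z : continuous (\0 : {linear X -> X}) by exact: cst_continuous.
have := is_bochner_integral_linear z (mble_itv _ _ _ _) (lebesgue_itv_lty _ _ _ _)
  (input_integralP rl t0 (Lp_on0 t)).
move=> h; apply: bochner_integralE; [exact: mble_itv|exact: lebesgue_itv_lty|].
apply: eq_is_bochner_integral h; first exact: mble_itv.
by move=> s _; rewrite /= Bop0// linear0.
Qed.

Lemma input_integral_domA_concat (lam a b : R) u v w : rho lam -> 0 <= a -> 0 <= b ->
  Lp a u -> Lp b v ->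
  (forall s, `[0, a]%classic s -> w s = u s) ->
  (forall r, `]0, b]%classic r -> w (r + a) = v r) ->
  domA D Q (input lam a u) -> domA D Q (input lam b v) ->
  domA D Q (input lam (b + a) w).
Proof.
move=> rl a0 b0 up vp wu wv Du Dv; rewrite (input_integral_concat rl a0 b0 up vp wu wv).
have [DT _] := semigroup_domA A_generates b0 Du.
by have [] := linear_onD domA_linear DT Dv.
Qed.

Hypothesis B_admissible : boundary_admissible D Am Q B T p.

Lemma input_integral_domA (lam t : R) u : rho lam -> 0 <= t -> Lp t u ->
  domA D Q (input lam t u).
Proof.
move=> rl t0 up; have [t1 [lam1 [t10 rl1 adm]]] := B_admissible.
apply: (input_integral_domA_resolvent rl1 rl t0 up).
have adm1 v : Lp t1 v -> domA D Q (input lam1 t1 v).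
  by move=> vp; apply: adm; apply/Lp_funE.
have admn n : forall v, Lp (t1 * n.+1%:R) v -> domA D Q (input lam1 (t1 * n.+1%:R) v).
  elim: n => [v|n ih v]; first by rewrite mulr1; exact: adm1.
  have -> : t1 * n.+2%:R = t1 + t1 * n.+1%:R by rewrite -natr1 mulrDr mulr1 addrC.
  have tn0 : 0 <= t1 * n.+1%:R by rewrite mulr_ge0// ltW.
  move=> vp; have vl := Lp_on_left (ltW t10) vp; have vr := Lp_on_right tn0 vp.
  by apply: (input_integral_domA_concat rl1 tn0 (ltW t10) vl vr) => //; [exact: ih|exact: adm1].
pose n := Num.truncn (t / t1).
have tn : t <= t1 * n.+1%:R.
  by rewrite mulrC -ler_pdivrMr// ltW// truncnS_gt.
(* Delaying [u] by [a] fills a whole multiple of [t1]; the zero input before it adds only the image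
   of 0 under [T t]. *)
pose a := t1 * n.+1%:R - t; have a0 : 0 <= a by rewrite subr_ge0.
pose w := concat a (fun=> 0) u.
have w1 s : `[0, a]%classic s -> w s = 0.
  by rewrite /= in_itv /= => /andP[_ sa]; exact: concatE1.
have w2 r : `]0, t]%classic r -> w (r + a) = u r.
  by rewrite /= in_itv /= => /andP[r0 _]; exact: concatE2.
have := input_integral_concat rl1 a0 t0 (Lp_on0 a) up w1 w2.
rewrite input_integral0// linear0 add0r => <-.
have wp := Lp_on_concat a0 t0 (Lp_on0 a) up w1 w2.
rewrite [t + a]addrC subrK in wp *; exact: admn.
Qed.

Lemma controllability_map_concat (lam a b : R) u v w : rho lam -> 0 <= a -> 0 <= b ->
  Lp a u -> Lp b v ->
  (forall s, `[0, a]%classic s -> w s = u s) ->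
  (forall r, `]0, b]%classic r -> w (r + a) = v r) ->
  controllability_map D Am Q B T lam (b + a) w =
    T b (controllability_map D Am Q B T lam a u) + controllability_map D Am Q B T lam b v.
Proof.
move=> rl a0 b0 up vp wu wv; rewrite /controllability_map.
rewrite (input_integral_concat rl a0 b0 up vp wu wv).
have Du := input_integral_domA rl a0 up; have Dv := input_integral_domA rl b0 vp.
have [DT AT] := semigroup_domA A_generates b0 Du.
have [_ ->] := linear_onD domA_linear DT Dv.
by rewrite AT linearB linearZ scalerDr opprD addrACA.
Qed.

End Input.

Section PositiveInputs.
Context (R : realType) (U : banachLatticeType R) (p : \bar R) (p_ge1 : (1 <= p)%E).
Local Notation mu := (@lebesgue_measure R).

Lemma Lp_posE t (u : R -> U) : Lp_pos p t u <-> Lp_on p `[0, t] u /\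
  {ae mu, forall s, s \in `[0, t] -> positive_cone (u s)}.
Proof. by rewrite /Lp_pos /= (Lp_funE _ _ p_ge1). Qed.

Lemma Lp_pos_left a b (w : R -> U) : 0 <= b -> Lp_pos p (b + a) w -> Lp_pos p a w.
Proof.
move=> b0 /Lp_posE[wp wpos]; apply/Lp_posE; split; first exact: Lp_on_left wp.
apply: ae_imp wpos => s ws sa; apply: ws; move: sa; rewrite !in_itv /= => /andP[-> sa].
by rewrite (le_trans sa)// lerDr.
Qed.

Lemma Lp_pos_right a b (w : R -> U) : 0 <= a -> Lp_pos p (b + a) w ->
  Lp_pos p b (fun r => w (r + a)).
Proof.
move=> a0 /Lp_posE[wp wpos]; apply/Lp_posE; split; first exact: Lp_on_right wp.
apply: ae_imp (ae_shift a wpos) => s ws sb; apply: ws; move: sb.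
by rewrite !in_itv /= => /andP[s0 sb]; rewrite addr_ge0// lerD2r.
Qed.

Lemma Lp_pos_concat a b (u v : R -> U) : 0 <= a -> 0 <= b ->
  Lp_pos p a u -> Lp_pos p b v -> Lp_pos p (b + a) (concat a u v).
Proof.
move=> a0 b0 /Lp_posE[up upos] /Lp_posE[vp vpos]; apply/Lp_posE; split.
  apply: Lp_on_concat up vp _ _ => // s; rewrite /= in_itv /= => /andP[? ?].
    exact: concatE1.
  exact: concatE2.
apply: ae_imp (ae_and upos (ae_shift (- a) vpos)) => s [us vs].
rewrite in_itv /= /concat => /andP[s0 sab]; case: leP => [sa|as_].
  by apply: us; rewrite in_itv /= s0.
by apply: vs; rewrite in_itv /= subr_ge0 ltW//= lerBlDr.
Qed.

End PositiveInputs.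

(** * The reachability space *)

Theorem corollary4p7 (R : realType) (X U : banachLatticeType R)
  (dX : completeNormedModType R)
  (D : set X) (Am : X -> X) (Q : X -> dX) (B : {linear U -> dX})
  (T : R -> {linear X -> X})
  (Am_linear : linear_on D Am) (Am_closed : closed_op D Am) (Am_dense : dense D)
  (Q_linear : linear_on D Q) (Q_bounded : graph_bounded D Am Q)
  (B_bounded : continuous B)
  (A_generates : generates (domA D Q) Am T)
  (Q_surjective : forall y : dX, exists2 x, D x & Q x = y)
  (p : \bar R) (p_ge1 : (1 <= p)%E)
  (B_admissible : boundary_admissible D Am Q B T p)
  (t : R) (t_gt0 : 0 < t) (n : nat) (n_gt0 : (0 < n)%N)
  (lam : R) (lam_resolvent : resolvent_set (domA D Q) Am lam) :
  let M := controllability_map D Am Q B T lam t in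
  exact_pos_reach D Am Q B T p lam (n%:R * t) =
    [set x | exists2 u : 'I_n -> R -> U, forall k, Lp_pos p t (u k) &
       x = \sum_(k < n) iter k (T t) (M (u k))] /\
  (positive_map p t M <->
     approx_pos_reach D Am Q B T p lam t `<=` @positive_cone R X).
Proof.
move=> M; split; last first.
  split=> [Mpos|reach u up].
    have -> : @positive_cone R X = closure (@positive_cone R X).
      exact/closure_id/positive_cone_closed.
    by apply: closureS => _ [u up <-]; exact: Mpos.
  by apply: reach; apply: subset_closure; exists u.
have t0 := ltW t_gt0.
have mapC m u v w : Lp_pos p (m.+1%:R * t) u -> Lp_pos p t v ->
    (forall s, `[0, m.+1%:R * t]%classic s -> w s = u s) ->
    (forall r, `]0, t]%classic r -> w (r + m.+1%:R * t) = v r) ->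
    controllability_map D Am Q B T lam (m.+2%:R * t) w =
    T t (controllability_map D Am Q B T lam (m.+1%:R * t) u) + M v.
  move=> /(Lp_posE p_ge1)[up _] /(Lp_posE p_ge1)[vp _] wu wv.
  have -> : m.+2%:R * t = t + m.+1%:R * t by rewrite -natr1 mulrDl mul1r addrC.
  have mt0 : 0 <= m.+1%:R * t by rewrite mulr_ge0.
  exact: (controllability_map_concat Am_linear Am_closed Q_linear Q_bounded B_bounded
    A_generates Q_surjective p_ge1 B_admissible lam_resolvent mt0 t0 up vp wu wv).
(* Indices run backwards in time: [u ord0] is the last piece, and [T t] factors out of all earlier
   ones. *)
have sumC m (u : 'I_m.+2 -> R -> U) : \sum_(k < m.+2) iter k (T t) (M (u k)) =
    T t (\sum_(k < m.+1) iter k (T t) (M (u (lift ord0 k)))) + M (u ord0).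
  by rewrite big_ord_recl addrC linear_sum.
case: n n_gt0 => // m _; apply/seteqP; split => x /=.
  move=> [w wp <-]; elim: m w wp => [|m ih] w wp.
    exists (fun=> w) => [_|]; first by rewrite mul1r in wp.
    by rewrite big_ord1 mul1r.
  have wp' : Lp_pos p (t + m.+1%:R * t) w.
    by move: wp; rewrite -natr1 mulrDl mul1r addrC.
  have mt0 : 0 <= m.+1%:R * t by rewrite mulr_ge0.
  have wl := Lp_pos_left p_ge1 t0 wp'; have wr_pos := Lp_pos_right p_ge1 mt0 wp'.
  have [u up uE] := ih w wl.
  (* The last piece of [w], translated to start at 0; [u'] puts it at index 0 and moves the pieces
     of the shorter input up by one. *)
  pose wr k r := w (r + k.+1%:R * t).
  pose u' k := if unlift ord0 k is Some j then u j else wr m.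
  have u'0 : u' ord0 = wr m by rewrite /u' unlift_none.
  have u'S k : u' (lift ord0 k) = u k by rewrite /u' liftK.
  exists u'; first by move=> k; rewrite /u'; case: unliftP => [j|] _.
  rewrite sumC u'0; under eq_bigr do rewrite u'S.
  (* Here [w] also plays the role of its own initial part. *)
  by rewrite (mapC m w (wr m) w)// uE.
move=> [u up ->]; elim: m u up => [|m ih] u up.
  by exists (u ord0); rewrite ?big_ord1 mul1r.
have [v vp vE] := ih (fun k => u (lift ord0 k)) (fun k => up _).
have mt0 : 0 <= m.+1%:R * t by rewrite mulr_ge0.
exists (concat (m.+1%:R * t) v (u ord0)).
  rewrite -natr1 mulrDl mul1r addrC; exact: Lp_pos_concat.
rewrite (mapC m v (u ord0)) ?vE ?sumC//.
  by move=> s; rewrite /= in_itv /= => /andP[_]; exact: concatE1.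
by move=> r; rewrite /= in_itv /= => /andP[r0 _]; exact: concatE2.
Qed.
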